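(* $$H_d\big(\mathsf{FT}(\iota_\ast Com)\big)(3,0)=\begin{cases}\mathbb{Q}&\text{if } d=-6,\\ 0&\text{else.}\end{cases}$$
   Context: Work over $k=\mathbb Q$, with homologically graded complexes. A graph consists of finite sets of vertices (non-empty) and flags (half-edges), an adjacency map from flags to vertices and an involution on flags; edges are the 2-element orbits, legs the fixed points (loops and multiple edges are allowed). A modular graph of type $(g,n)$ is a connected graph with at least one edge, with $n$ legs labeled by $\{1,\dots,n\}$, with vertices labeled by genera $g(v)\ge0$ satisfying $2g(v)+\|v\|\ge3$ ($\|v\|$ the number of flags at $v$) and with first Betti number plus sum of genus labels equal to $g$. $Com$ is the cyclic commutative operad and $\iota_\ast Com$ its modular envelope: the modular operad with $\iota_\ast Com(g,n)=k$ in degree $0$ with trivial $S_n$-action for all $(g,n)$ with $2g+n\ge3$, all graph compositions being the identity of $k$. $\mathsf{FT}$ is the Feynman transform: for a modular operad $A$, $\mathsf{FT}(A)(g,n)=\bigoplus_\gamma\big(\mathfrak K(\gamma)\otimes\bigotimes_vA(g(v),\mathrm{fl}(v))^\ast\big)_{\mathrm{Aut}(\gamma)}$, summed over isomorphism classes of modular graphs of type $(g,n)$ together with the one-vertex graph without edges, where $\mathfrak K(\gamma)$ is the one-dimensional vector space in degree minus the number of edges of $\gamma$ on which permutations of edges act by their sign, and $\mathrm{Aut}(\gamma)$ is the automorphism group fixing the legs. The differential (degree $-1$) is the internal differential plus the linear dual of the one-edge compositions of $A$: it sums over all ways of expanding a vertex into a graph with one edge (including replacing a genus label $g(v)\ge1$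 by $g(v)-1$ and a new loop), the new edge being placed in a fixed extremal position of the edge order. *)

(* Defs.v *)
From HB Require Import structures.
From mathcomp Require Import all_boot all_order all_algebra perm.
From mathcomp Require Import boolp finmap monalg.

Set Implicit Arguments.
Unset Strict Implicit.
Unset Printing Implicit Defensive.

Import GRing.Theory.

Local Open Scope ring_scope.

Inductive in_span (V : lmodType rat) (S : V -> Prop) : V -> Prop :=
| in_span0 : in_span S 0
| in_spanP (c : rat) (x y : V) : S x -> in_span S y -> in_span S (c *: x + y).

Definition spanp (V : lmodType rat) (S : V -> Prop) : {pred V} :=
  fun x => `[< in_span S x >].

Lemma spanp_closed (V : lmodType rat) (S : V -> Prop) :
  submod_closed (spanp S).
Proof.
split=> [|c x y]; first by apply/asboolP; left.
move=> /asboolP Sx /asboolP Sy; apply/asboolP.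
elim: Sx => [|e u z Su _ IH]; first by rewrite scaler0 add0r.
by rewrite scalerDr scalerA -addrA; right.
Qed.

HB.instance Definition _ (V : lmodType rat) (S : V -> Prop) :=
  GRing.isSubmodClosed.Build rat V (spanp S) (spanp_closed S).

Section SubQuotient.
Variables (V : lmodType rat) (Z B : submodClosed V).

Definition submod : Type := {x : V | x \in Z}.
HB.instance Definition _ := SubChoice.on submod.
HB.instance Definition _ := [SubChoice_isSubLmodule of submod by <:].

Definition rel_in : {pred submod} := fun x => val x \in B.

Lemma rel_inE x : (x \in rel_in) = (val x \in B).
Proof. by []. Qed.

Lemma rel_in_closed : submod_closed rel_in.
Proof.
split=> [|c x y]; rewrite !rel_inE ?raddf0 ?rpred0 //.
by move=> Bx By; rewrite linearP /= rpredD ?rpredZ.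
Qed.

HB.instance Definition _ :=
  GRing.isSubmodClosed.Build rat submod rel_in rel_in_closed.

(* The vector space Z / (B :&: Z). *)
Definition subquot : Type := Quotient.quot rel_in.
HB.instance Definition _ := GRing.Zmodule.on subquot.
HB.instance Definition _ := EqQuotient.copy subquot (Quotient.quot rel_in).

Local Open Scope quotient_scope.

Lemma pi_sqD (x y : submod) :
  \pi_subquot (x + y) = \pi_subquot x + \pi_subquot y.
Proof. exact: Quotient.pi_add. Qed.

Definition sq_scale (c : rat) (x : subquot) : subquot :=
  \pi_subquot (c *: repr x).

Lemma pi_sq_scale c (x : submod) :
  sq_scale c (\pi_subquot x) = \pi_subquot (c *: x).
Proof.
apply/eqP; rewrite -Quotient.idealrBE -scalerBr rpredZ //.
rewrite Quotient.idealrBE; apply/eqP; exact: reprK.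
Qed.

Lemma sq_scaleA a b x : sq_scale a (sq_scale b x) = sq_scale (a * b) x.
Proof. by elim/quotW: x => x; rewrite (pi_sq_scale b) !pi_sq_scale scalerA. Qed.

Lemma sq_scale1 : left_id 1 sq_scale.
Proof. by elim/quotW=> x; rewrite pi_sq_scale scale1r. Qed.

Lemma sq_scaleDr : right_distributive sq_scale +%R.
Proof.
move=> c; elim/quotW=> x; elim/quotW=> y.
rewrite -pi_sqD (pi_sq_scale c (x + y)) scalerDr pi_sqD.
by rewrite (pi_sq_scale c x) (pi_sq_scale c y).
Qed.

Lemma sq_scaleDl x : {morph sq_scale^~ x : a b / a + b}.
Proof.
elim/quotW: x => x a b; rewrite (pi_sq_scale (a + b)) scalerDl pi_sqD.
by rewrite (pi_sq_scale a) (pi_sq_scale b).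
Qed.

HB.instance Definition _ := GRing.Zmodule_isLmodule.Build rat subquot
  sq_scaleA sq_scale1 sq_scaleDr sq_scaleDl.

End SubQuotient.

Definition lmod_iso (U V : lmodType rat) : Prop :=
  exists f : {linear U -> V}, bijective f.

(* A g S is the arity (g, S) component, S being a finite subset of some finite
   set F. *)
Definition arity_family := nat -> forall F : finType, {set F} -> vectType rat.

(* The identity if (g, S) = (g', S'), and 0 otherwise.  It is only meant to be
   used when (g, S) and (g', S') are provably equal. *)
Definition coe (A : arity_family) (g : nat) (F : finType) (S : {set F})
    (g' : nat) (S' : {set F}) (x : A g F S) : A g' F S' :=
  match g =P g', S =P S' with
  | ReflectT eg, ReflectT eS =>
      ecast k (A k F S') eg (ecast U (A g F U) eS x)
  | _, _ => 0
  end.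

Arguments coe {A g F S g'} S' x.

(* Modular operads in finite dimensional rational vector spaces, i.e. modular
   operads concentrated in homological degree 0.
   - mo_pull f : relabelling along the bijection f : S -> f @: S
     (f is required to be injective on S in all axioms);
   - mo_glue a b : composition along an edge {a, b} joining two vertices
     (relevant for S, T disjoint, a in S, b in T);
   - mo_loop a b : composition along a loop {a, b} at one vertex
     (relevant for a, b distinct in S).
   The unstable components (2g + #|S| < 3) play no role: a modular operad that
   is only given in the stable range extends by 0. *)
Record mod_operad := ModOperad {
  mo_sp : arity_family;
  mo_pull : forall (g : nat) (F F' : finType) (f : F -> F') (S : {set F}),
    mo_sp g (f @: S) -> mo_sp g S;
  mo_glue : forall (g h : nat) (F : finType) (S T : {set F}) (a b : F),
    mo_sp g S -> mo_sp h T -> mo_sp (g + h)%N ((S :\ a) :|: (T :\ b));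
  mo_loop : forall (g : nat) (F : finType) (S : {set F}) (a b : F),
    mo_sp g S -> mo_sp g.+1 (S :\ a :\ b);

  mo_pull_linear : forall g (F F' : finType) (f : F -> F') (S : {set F}),
    linear (@mo_pull g F F' f S);
  mo_glue_linearl : forall g h (F : finType) (S T : {set F}) a b y,
    linear (fun x => @mo_glue g h F S T a b x y);
  mo_glue_linearr : forall g h (F : finType) (S T : {set F}) a b x,
    linear (@mo_glue g h F S T a b x);
  mo_loop_linear : forall g (F : finType) (S : {set F}) a b,
    linear (@mo_loop g F S a b);

  mo_pull_id : forall g (F : finType) (S : {set F}) (x : mo_sp g (id @: S)),
    mo_pull x = coe S x;
  mo_pull_comp : forall g (F F' F'' : finType) (f : F -> F') (f' : F' -> F'')
      (S : {set F}) (x : mo_sp g (f' @: (f @: S))),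
    {in S &, injective (f' \o f)} ->
    mo_pull (coe ((f' \o f) @: S) x) = mo_pull (mo_pull x);
  mo_pull_ext : forall g (F F' : finType) (f f' : F -> F') (S : {set F})
      (x : mo_sp g (f @: S)),
    {in S &, injective f} -> {in S, f =1 f'} ->
    mo_pull (coe (f' @: S) x) = mo_pull x;

  mo_pull_glue : forall g h (F F' : finType) (f : F -> F') (S T : {set F}) a b
      (x : mo_sp g (f @: S)) (y : mo_sp h (f @: T)),
    {in S :|: T &, injective f} -> [disjoint S & T] -> a \in S -> b \in T ->
    mo_pull (coe (f @: ((S :\ a) :|: (T :\ b))) (mo_glue (f a) (f b) x y))
    = mo_glue a b (mo_pull x) (mo_pull y);
  mo_pull_loop : forall g (F F' : finType) (f : F -> F') (S : {set F}) a b
      (x : mo_sp g (f @: S)),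
    {in S &, injective f} -> a \in S -> b \in S -> a != b ->
    mo_pull (coe (f @: (S :\ a :\ b)) (mo_loop (f a) (f b) x))
    = mo_loop a b (mo_pull x);

  mo_glueC : forall g h (F : finType) (S T : {set F}) a b
      (x : mo_sp g S) (y : mo_sp h T),
    [disjoint S & T] -> a \in S -> b \in T ->
    coe _ (mo_glue b a y x) = mo_glue a b x y;
  mo_loopC : forall g (F : finType) (S : {set F}) a b (x : mo_sp g S),
    a \in S -> b \in S -> a != b ->
    coe _ (mo_loop b a x) = mo_loop a b x;

  mo_glueA : forall g h k (F : finType) (S T U : {set F}) a b c d
      (x : mo_sp g S) (y : mo_sp h T) (z : mo_sp k U),
    [disjoint S & T] -> [disjoint S & U] -> [disjoint T & U] ->
    a \in S -> b \in T -> c \in T -> d \in U -> b != c ->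
    coe _ (mo_glue a b x (mo_glue c d y z))
    = mo_glue c d (mo_glue a b x y) z;
  mo_loop_loop : forall g (F : finType) (S : {set F}) a b c d
      (x : mo_sp g S),
    a \in S -> b \in S -> c \in S -> d \in S -> uniq [:: a; b; c; d] ->
    coe _ (mo_loop c d (mo_loop a b x)) = mo_loop a b (mo_loop c d x);
  mo_loop_glue : forall g h (F : finType) (S T : {set F}) a b c d
      (x : mo_sp g S) (y : mo_sp h T),
    [disjoint S & T] -> a \in S -> b \in T -> c \in S -> d \in S ->
    uniq [:: a; c; d] ->
    coe _ (mo_loop c d (mo_glue a b x y)) = mo_glue a b (mo_loop c d x) y;
  mo_loop_glue2 : forall g h (F : finType) (S T : {set F}) a b c d
      (x : mo_sp g S) (y : mo_sp h T),
    [disjoint S & T] -> a \in S -> b \in T -> c \in S -> d \in T ->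
    a != c -> b != d ->
    coe _ (mo_loop c d (mo_glue a b x y)) = mo_loop a b (mo_glue c d x y)
}.

(* The modular envelope of the cyclic commutative operad: Q in every arity, all
   structure maps being the identity of Q.  Its values in the unstable arities
   are irrelevant. *)
Section IotaCom.

Definition icom_sp : arity_family := fun _ _ _ => rat^o.
Definition icom_pull g (F F' : finType) (f : F -> F') (S : {set F})
  (x : icom_sp g (f @: S)) : icom_sp g S := x.
Definition icom_glue g h (F : finType) (S T : {set F}) (a b : F)
  (x : icom_sp g S) (y : icom_sp h T) :
  icom_sp (g + h)%N ((S :\ a) :|: (T :\ b)) := (x : rat) * (y : rat).
Definition icom_loop g (F : finType) (S : {set F}) (a b : F)
  (x : icom_sp g S) : icom_sp g.+1 (S :\ a :\ b) := x.

Lemma icom_coe g (F : finType) (S : {set F}) g' (S' : {set F})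
    (x : icom_sp g S) :
  g = g' -> S = S' -> coe (A := icom_sp) (g' := g') S' x = x.
Proof.
move=> eg eS; rewrite /coe; case: eqP => // {}eg; case: eqP => // {}eS.
by case: _ / eg; case: _ / eS.
Qed.

Lemma rato_mull (R : comPzRingType) (y : R) :
  linear (fun x : R^o => x * y : R^o).
Proof. by move=> c x x'; rewrite mulrDl -mulrA. Qed.

Lemma rato_mulr (R : comPzRingType) (x : R) :
  linear (fun y : R^o => x * y : R^o).
Proof. by move=> c y y'; rewrite mulrDr mulrCA. Qed.

Lemma imsetD1_in (F F' : finType) (f : F -> F') (S U : {set F}) a :
  {in U &, injective f} -> S \subset U -> a \in U ->
  f @: (S :\ a) = (f @: S) :\ f a.
Proof.
move=> injf /subsetP SU aU; apply/setP=> y; rewrite in_setD1.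
apply/imsetP/andP=> [[x] | [yn /imsetP[x xS ey]]].
  rewrite in_setD1 => /andP[xa xS] ->; split; last exact: imset_f.
  by apply: contraNneq xa => /injf<- //; exact: SU.
exists x; rewrite // in_setD1 xS andbT.
by apply: contraNneq yn => <-; rewrite ey.
Qed.

Definition iota_Com : mod_operad.
Proof.
refine (@ModOperad icom_sp icom_pull icom_glue icom_loop
  _ _ _ _ _ _ _ _ _ _ _ _ _ _ _).
- by [].
- by move=> g h F S T a b y; apply: rato_mull.
- by move=> g h F S T a b x; apply: rato_mulr.
- by [].
- by move=> g F S x; rewrite icom_coe ?imset_id.
- move=> g F F' F'' f f' S x _.
  exact: (icom_coe x (erefl g) (esym (imset_comp f' f S))).
- move=> g F F' f f' S x _ ff'.
  exact: (icom_coe x (erefl g) (eq_in_imset ff')).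
- move=> g h F F' f S T a b x y injf _ aS bT.
  refine (icom_coe (icom_glue (f a) (f b) x y) (erefl _) _).
  by rewrite imsetU !(imsetD1_in injf) ?subsetUl ?subsetUr // inE ?aS ?bT ?orbT.
- move=> g F F' f S a b x injf aS bS _.
  refine (icom_coe (icom_loop (f a) (f b) x) (erefl _) _).
  by rewrite !(imsetD1_in injf) ?subD1set.
- move=> g h F S T a b x y _ _ _.
  refine (etrans (icom_coe (icom_glue b a y x) (addnC _ _) (setUC _ _)) _).
  exact: mulrC.
- move=> g F S a b x _ _ _.
  refine (icom_coe (icom_loop b a x) (erefl _) _).
  by apply/setP=> u; rewrite !inE andbCA.
- move=> g h k F S T U a b c d x y z ST SU TU aS bT cT dU bc.
  refine (etrans (icom_coe (icom_glue a b x (icom_glue c d y z))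
                           (addnA _ _ _) _) _); last exact: mulrA.
  apply/setP=> u; rewrite !inE.
  have [->|uc] := eqVneq u c.
    by rewrite (disjointFl ST cT) (disjointFr TU cT) !andbF.
  have [->|ub] := eqVneq u b; last by rewrite orbA.
  by rewrite (disjointFl ST bT) (disjointFr TU bT) !andbF.
- move=> g F S a b c d x _ _ _ _ _.
  refine (icom_coe (icom_loop c d (icom_loop a b x)) (erefl _) _).
  by apply/setP=> u; rewrite !inE; do !case: (_ == _).
- move=> g h F S T a b c d x y ST aS bT cS dS _.
  refine (icom_coe (icom_loop c d (icom_glue a b x y)) (esym (addSn _ _)) _).
  apply/setP=> u; rewrite !inE.
  have [->|uc] := eqVneq u c; first by rewrite (disjointFr ST cS) !andbF.
  have [->|ud] := eqVneq u d; first by rewrite (disjointFr ST dS) !andbF.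
  by [].
- move=> g h F S T a b c d x y ST aS bT cS dT ac bd.
  refine (icom_coe (icom_loop c d (icom_glue a b x y)) (erefl _) _).
  apply/setP=> u; rewrite !inE.
  have [->|ua] := eqVneq u a; first by rewrite (disjointFr ST aS) !andbF.
  have [->|ub] := eqVneq u b; first by rewrite (disjointFl ST bT) !andbF.
  have [->|uc] := eqVneq u c; first by rewrite (disjointFr ST cS) !andbF.
  have [->|ud] := eqVneq u d; first by rewrite (disjointFl ST dT) !andbF.
  by [].
Defined.

End IotaCom.

Arguments mo_pull {m g F F'} f {S} x.
Arguments mo_glue {m g h F S T} a b x y.
Arguments mo_loop {m g F S} a b x.

(* Since graphs only matter up to isomorphism, the sets of vertices and flags
   are taken of the form {0, ..., m - 1}; the legs are labelled by
   {0, ..., n - 1}.  This is raw data, on which [modular_type] below imposes the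
   conditions. *)
Record graph (n : nat) := Graph {
  nvert : nat;
  nflag : nat;
  vtx : 'I_nflag -> 'I_nvert;
  inv : 'I_nflag -> 'I_nflag;
  genus : 'I_nvert -> nat;
  leg : 'I_n -> 'I_nflag
}.

Section GraphTheory.
Variables (n : nat) (G : graph n).

Definition fl (v : 'I_(nvert G)) : {set 'I_(nflag G)} := [set x | vtx x == v].

Definition edges : {set {set 'I_(nflag G)}} :=
  [set [set x; inv x] | x in [set x | inv x != x]].

Definition adj : rel 'I_(nvert G) :=
  fun u v => [exists x, (vtx x == u) && (vtx (inv x) == v)].

Definition betti1 : nat := (#|edges| + n_comp adj predT - nvert G)%N.

(* The graph with one vertex and no edges is allowed. *)
Definition modular_type (g : nat) : Prop :=
  [/\ [/\ involutive (@inv n G),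
          injective (@leg n G) &
          forall x, inv x = x <-> exists i, leg G i = x],
      (0 < nvert G)%N /\ (forall u v, connect adj u v),
      forall v, (3 <= 2 * genus v + #|fl v|)%N &
      (betti1 + \sum_(v < nvert G) genus v)%N = g].

End GraphTheory.

Definition ext (T : Type) (m : nat) (t : T) (f : 'I_m -> T) : 'I_m.+1 -> T :=
  fun i => oapp f t (unlift ord0 i).

(* The flags of an expanded graph: the two halves [fa], [fb] of the new edge,
   and the old flags [fkeep x]. *)
Definition fa (m : nat) : 'I_m.+2 := ord0.
Definition fb (m : nat) : 'I_m.+2 := lift ord0 ord0.
Definition fkeep (m : nat) (x : 'I_m) : 'I_m.+2 := lift ord0 (lift ord0 x).

Section Expansions.
Variables (n : nat) (G : graph n) (w : 'I_(nvert G)).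

(* The vertex w is split: the flags in P and the genus h go to a new vertex
   (number ord0), the rest remains at w (now numbered lift ord0 w), and the two
   are joined by a new edge. *)
Definition split_graph (P : {set 'I_(nflag G)}) (h : nat) : graph n :=
  @Graph n (nvert G).+1 (nflag G).+2
    (ext (lift ord0 w) (ext ord0
       (fun x => if x \in P then ord0 else lift ord0 (vtx x))))
    (ext (fb _) (ext (fa _) (fun x => fkeep (inv x))))
    (ext h (fun v => if v == w then genus v - h else genus v)%N)
    (fun i => fkeep (leg G i)).

(* A loop is attached to w, and the genus of w is lowered by one. *)
Definition loop_graph : graph n :=
  @Graph n (nvert G) (nflag G).+2
    (ext w (ext w (@vtx n G)))
    (ext (fb _) (ext (fa _) (fun x => fkeep (inv x))))
    (fun v => if v == w then (genus v).-1 else genus v)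
    (fun i => fkeep (leg G i)).

(* Edge orders are sequences of edges; the new edge is placed first. *)
Definition new_order (o : seq {set 'I_(nflag G)}) :
    seq {set 'I_(nflag G).+2} :=
  [set fa _; fb _] :: [seq [set fkeep x | x in e] | e : {set _} <- o].

End Expansions.

Section Decorations.
Variables (A : mod_operad) (n : nat).

Definition decor (G : graph n) : Type :=
  forall v : 'I_(nvert G), mo_sp A (genus v) (fl v).

(* The components being finite dimensional, the tensor product over the vertices
   v of the duals of A(g(v), fl(v)) is the space of multilinear forms on the
   product of the A(g(v), fl(v)). *)
Definition multilinear (G : graph n) (p : decor G -> rat) : Prop :=
  forall (v : 'I_(nvert G)) (c : rat) (d d1 d2 : decor G),
    d v = c *: d1 v + d2 v ->
    (forall u, u != v -> d u = d1 u /\ d u = d2 u) ->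
    p d = c * p d1 + p d2.

Variable G : graph n.

Definition contract_split (w : 'I_(nvert G)) P h
    (d : decor (split_graph w P h)) : decor G :=
  fun v => mo_pull (@fkeep _)
    (if v == w then
       coe (@fkeep _ @: fl v) (mo_glue (fa _) (fb _) (d (lift ord0 v)) (d ord0))
     else coe (@fkeep _ @: fl v) (d (lift ord0 v))).

Definition contract_loop (w : 'I_(nvert G)) (d : decor (loop_graph w)) :
    decor G :=
  fun v => mo_pull (@fkeep _)
    (if v == w then coe (@fkeep _ @: fl v) (mo_loop (fa _) (fb _) (d v))
     else coe (@fkeep _ @: fl v) (d v)).

Definition transport (H : graph n) (fV : 'I_(nvert G) -> 'I_(nvert H))
    (fF : 'I_(nflag G) -> 'I_(nflag H)) (d : decor H) : decor G :=
  fun v => mo_pull fF (coe (fF @: fl v) (d (fV v))).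

Definition graph_iso (H : graph n) (fV : 'I_(nvert G) -> 'I_(nvert H))
    (fF : 'I_(nflag G) -> 'I_(nflag H)) : Prop :=
  [/\ bijective fV /\ bijective fF,
      forall x, vtx (fF x) = fV (vtx x),
      forall x, inv (fF x) = fF (inv x),
      forall v, genus (fV v) = genus v &
      forall i, fF (leg G i) = leg H i].

End Decorations.

Section FeynmanTransform.
Variables (A : mod_operad) (g n : nat).

(* A graph, with an order of its edges (i.e. a generator of K(G), up to sign)
   and a multilinear form on its decorations. *)
Record generator := Generator {
  gr : graph n;
  ord : seq {set 'I_(nflag gr)};
  form : decor A gr -> rat
}.

Definition admissible (k : generator) : Prop :=
  [/\ modular_type (gr k) g,
      uniq (ord k) /\ ord k =i edges (gr k) &
      multilinear (@form k)].

Definition degree (k : generator) : int := - (size (ord k))%:Z.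

Definition prechain : lmodType rat := {malg rat[{classic generator}]}.

Definition gen (G : graph n) (o : seq {set 'I_(nflag G)})
    (p : decor A G -> rat) : prechain :=
  << (Generator o p : {classic generator}) >>.

Inductive relator : prechain -> Prop :=
| relator_lin (G : graph n) (o : seq {set 'I_(nflag G)}) (c : rat)
    (p q : decor A G -> rat) :
    admissible (Generator o p) -> admissible (Generator o q) ->
    relator (gen o (fun d => c * p d + q d) - (c *: gen o p + gen o q))
| relator_iso (G H : graph n)
    (o : seq {set 'I_(nflag G)}) (o' : seq {set 'I_(nflag H)})
    (p : decor A G -> rat) (q : decor A H -> rat)
    (fV : 'I_(nvert G) -> 'I_(nvert H)) (fF : 'I_(nflag G) -> 'I_(nflag H))
    (s : 'S_(size o)) :
    admissible (Generator o p) -> admissible (Generator o' q) ->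
    graph_iso fV fF ->
    (forall i : 'I_(size o), nth set0 o' i = fF @: nth set0 o (s i)) ->
    (forall d : decor A H, q d = p (transport fV fF d)) ->
    relator (gen o' q - (-1) ^+ s *: gen o p).

(* The degree d part of FT(A)(g, n) is the quotient of [chains d] by its
   intersection with the span of the relators. *)
Definition chains (d : int) (x : prechain) : Prop :=
  forall k : {classic generator}, x@_k != 0 -> admissible k /\ degree k = d.

(* Each decomposition of w into two vertices occurs twice in the first sum (the
   two vertices are ordered), hence the factor 1/2. *)
Definition diff_gen (k : generator) : prechain :=
  2%:R^-1 *: (\sum_(w < nvert (gr k))
     \sum_(P : {set 'I_(nflag (gr k))} | P \subset fl w)
     \sum_(h < (genus w).+1 |
             (3 <= 2 * h + #|P|.+1)%N &&
             (3 <= 2 * (genus w - h) + #|fl w :\: P|.+1)%N)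
       gen (G := split_graph w P h) (new_order (ord k))
           (fun d => form (contract_split d)))
  + \sum_(w < nvert (gr k) | (0 < genus w)%N)
       gen (G := loop_graph w) (new_order (ord k))
           (fun d => form (contract_loop d)).

Definition diff (x : prechain) : prechain :=
  \sum_(k <- msupp x) x@_k *: diff_gen k.

Lemma diffE (x : prechain) (D : {fset {classic generator}}) :
  (msupp x `<=` D)%fset -> diff x = \sum_(k <- D) x@_k *: diff_gen k.
Proof.
move=> xD; apply: big_fset_incl => // k _ /mcoeff_outdom ->.
by rewrite scale0r.
Qed.

Lemma diff_linear : linear diff.
Proof.
move=> c x y.
pose D : {fset {classic generator}} :=
  (msupp (c *: x + y) `|` (msupp x `|` msupp y))%fset.
have [xD yD zD] : [/\ (msupp x `<=` D)%fset, (msupp y `<=` D)%fset &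
                      (msupp (c *: x + y) `<=` D)%fset].
  by split; apply/fsubsetP => k kx; rewrite !inE kx ?orbT.
rewrite (diffE xD) (diffE yD) (diffE zD) scaler_sumr -big_split.
apply: eq_bigr => k _ /=.
by rewrite mcoeffD mcoeffZ scalerDl scalerA.
Qed.

HB.instance Definition _ :=
  GRing.isLinear.Build rat prechain prechain *:%R diff diff_linear.

(* The differential of the quotient by the relators is computed on
   representatives: cycles are the chains with differential in the span of the
   relators, boundaries the elements of the span of the relators and of the
   differentials of chains. *)
Definition cycles (d : int) : {pred prechain} :=
  fun x => `[< chains d x /\ in_span relator (diff x) >].

Lemma cycles_closed (d : int) : submod_closed (cycles d).
Proof.
split=> [|c x y].
  apply/asboolP; split; first by move=> k; rewrite mcoeff0 eqxx.
  by rewrite linear0; left.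
move=> /asboolP[cx dx] /asboolP[cy dy]; apply/asboolP; split.
  move=> k; rewrite mcoeffD mcoeffZ => nz.
  have [yk0|/cy//] := eqVneq y@_k 0; apply: cx.
  by apply: contraNneq nz => ->; rewrite yk0 mulr0 addr0.
have Dx : diff x \in spanp relator by apply/asboolP.
have Dy : diff y \in spanp relator by apply/asboolP.
rewrite linearP; apply/(asboolP (in_span _ _)).
change (c *: diff x + diff y \in spanp relator).
by rewrite rpredD ?rpredZ.
Qed.

HB.instance Definition _ (d : int) :=
  GRing.isSubmodClosed.Build rat prechain (cycles d) (cycles_closed d).

Definition boundaries (d : int) : {pred prechain} :=
  spanp (fun x => relator x \/ exists2 y, chains (d + 1) y & x = diff y).

HB.instance Definition _ (d : int) :=
  GRing.SubmodClosed.on (boundaries d).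

Definition homology (d : int) : lmodType rat :=
  subquot (cycles d) (boundaries d).

End FeynmanTransform.

(* Main.v *)
(* A generator (graph, order of its edges, form) is, modulo the relators, a
   multiple of the same graph and order with the standard form, so the complex is
   spanned by isomorphism classes of stable graphs of genus 3, up to sign.  A
   double edge, or two loops at one vertex, gives an odd automorphism and kills
   the class; this and the other odd automorphisms leave 13 classes out of the
   graphs with at most 4 vertices and 6 edges.  One of them is the complete graph
   on 4 vertices; the 12 others are paired off by trading one unit of genus of a
   vertex for a loop, and the differential maps the first member of each pair to
   a non-zero multiple of the second plus other classes.  In each degree there is
   at most one first and one second member, so that these 12 classes contribute
   nothing to the homology.  Linear independence of the surviving classes is
   detected by linear forms summing the signs of all isomorphisms onto a fixed
   graph. *)

Require Import Defs.
From HB Require Import structures.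
From mathcomp Require Import all_boot all_order all_algebra perm.
From mathcomp Require Import boolp finmap monalg zify ring.

Set Implicit Arguments.
Unset Strict Implicit.
Unset Printing Implicit Defensive.

Import GRing.Theory.

Local Open Scope ring_scope.

(** * Multilinear forms and relators *)

(** Prechains have a basis of all graphs with all orders and forms, so the quotient by the relators
    is too large to be computed directly. It is approached from two sides. Explicit isomorphisms
    rewrite every class as a multiple of a listed one, which bounds the complex from above.
    Functions of graphs with ordered edges that change by the sign under isomorphisms vanish on the
    relators, which bounds it from below. That [diff] preserves the span of the relators is never
    proved. Instead, the transpose of [diff] maps invariant functions to invariant functions, which
    suffices to evaluate a detector on the differential of a chain known only modulo relators. With
    at most two classes in each degree, one detector gives the single linear equation that a cycle
    has to satisfy. Likewise the vanishing of the squared differential enters only as one numerical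
    identity per degree. All these finite checks are run by [vm_compute] on graphs encoded as
    lists. *)

Definition value n (G : graph n) (d : decor iota_Com G) v : rat := d v.

Definition unit_decor n (G : graph n) : decor iota_Com G := fun=> (1 : rat).

Definition prod_form n (G : graph n) (d : decor iota_Com G) : rat :=
  \prod_v value d v.

Lemma multilinear_prod n (G : graph n) : multilinear (@prod_form n G).
Proof.
move=> v c d d1 d2 dv du; rewrite /prod_form.
rewrite (bigD1 v) //= [in X in _ = _ * X + _](bigD1 v) //=.
rewrite [in X in _ = _ + X](bigD1 v) //=.
have <- : \prod_(i | i != v) value d i = \prod_(i | i != v) value d1 i.
  by apply: eq_bigr => u /du[]; rewrite /value => ->.
have <- : \prod_(i | i != v) value d i = \prod_(i | i != v) value d2 i.
  by apply: eq_bigr => u /du[_]; rewrite /value => ->.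
rewrite mulrA -mulrDl; congr (_ * _); exact: dv.
Qed.

(** All components of [iota_Com] are one-dimensional: replacing the arguments by 1, one vertex at a
    time, pulls out their values as factors. *)
Lemma multilinearE n (G : graph n) (p : decor iota_Com G -> rat) :
  multilinear p -> p = (fun d => p (@unit_decor n G) * prod_form d).
Proof.
move=> pL; apply: funext => d.
pose upd (r : seq 'I_(nvert G)) : decor iota_Com G :=
  fun v => if v \in r then (1 : rat) else value d v.
have key r : uniq r -> p d = (\prod_(v <- r) value d v) * p (upd r).
  elim: r => [_|v r IH /= /andP[vr /IH ->]].
    by rewrite big_nil mul1r; congr p; apply: funext.
  rewrite big_cons mulrAC mulrC; congr (_ * _).
  (* [multilinear] combines scaling and addition, so scaling alone needs a second summand on which
     [p] vanishes: a decoration that is 0 at [v]. *)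
  pose z : decor iota_Com G := fun u => if u == v then (0 : rat) else upd r u.
  have z0 : p z = 0.
    have h : p z = 1 * p z + p z.
      by apply: (pL v) => //; rewrite /z eqxx scaler0 addr0.
    by move/eqP: h; rewrite mul1r -subr_eq0 opprD addrA subrr sub0r oppr_eq0 => /eqP.
  have -> : p (upd r) = value d v * p (upd (v :: r)) + p z.
    apply: (pL v).
      rewrite /upd /z (negPf vr) inE !eqxx addr0 /=; exact: (esym (mulr1 _)).
    by move=> u uv; rewrite /upd /z inE (negPf uv).
  by rewrite z0 addr0.
rewrite (key (enum 'I_(nvert G))) ?enum_uniq // big_enum mulrC.
by congr (p _ * _); apply: funext => v; rewrite /upd mem_enum.
Qed.

Section Iso.
Variables (n : nat) (G H : graph n).
Variables (fV : 'I_(nvert G) -> 'I_(nvert H)) (fF : 'I_(nflag G) -> 'I_(nflag H)).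
Hypothesis iso : graph_iso fV fF.

Lemma iso_fl v : fl (fV v) = fF @: fl v.
Proof.
case: iso => -[/bij_inj injV bijF] vtxE _ _ _; have injF := bij_inj bijF.
apply/setP=> y; case: bijF => g gK Kg; rewrite -[y]Kg mem_imset //.
by rewrite !inE vtxE (inj_eq injV).
Qed.

Lemma transport_iota (d : decor iota_Com H) :
  transport fV fF d = (fun v => d (fV v)).
Proof.
case: (iso) => _ _ _ gE _; apply: funext => v.
by rewrite /transport; apply: icom_coe; rewrite ?gE ?iso_fl.
Qed.

Lemma prod_form_iso (d : decor iota_Com H) :
  prod_form (transport fV fF d) = prod_form d.
Proof.
case: iso => -[bV _] _ _ _ _.
by rewrite transport_iota /prod_form [RHS](reindex fV) //; exact: onW_bij.
Qed.

Lemma unit_decor_iso : transport fV fF (@unit_decor n H) = @unit_decor n G.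
Proof. by rewrite transport_iota. Qed.

End Iso.

Section Relators.
Variables g n : nat.
Local Notation C := (prechain iota_Com n).
Local Notation rel := (spanp (@relator iota_Com g n)).

Definition oriented (G : graph n) (o : seq {set (ordinal (nflag G))}) : C :=
  gen o (@prod_form n G).

Lemma relator_rel (x : C) : relator g x -> x \in rel.
Proof. by move=> Rx; apply/asboolP; rewrite -[x]addr0 -[x]scale1r; right=> //; left. Qed.

Definition oadmissible (G : graph n) (o : seq {set 'I_(nflag G)}) : Prop :=
  modular_type G g /\ (uniq o /\ o =i edges G).

Lemma admissible_prod (G : graph n) (o : seq {set 'I_(nflag G)}) c :
  oadmissible o ->
  admissible g (@Generator iota_Com n G o (fun d => c * prod_form d)).
Proof.
move=> [mG oG]; split=> //= v e d d1 d2 dv du.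
by rewrite (multilinear_prod dv du); ring.
Qed.

Lemma admissible_prod1 (G : graph n) (o : seq {set 'I_(nflag G)}) :
  oadmissible o -> admissible g (@Generator iota_Com n G o (@prod_form n G)).
Proof.
move=> /(admissible_prod 1); suff -> : (fun d => 1 * prod_form d) = @prod_form n G by [].
by apply: funext => d; rewrite mul1r.
Qed.

Lemma gen_scale (G : graph n) (o : seq {set 'I_(nflag G)}) c :
  oadmissible o ->
  gen o (fun d => c * prod_form d) - c *: oriented o \in rel.
Proof.
move=> ao; pose p c d := c * @prod_form n G d.
have lin a b : gen o (p (a * b + 0)) - (a *: gen o (p b) + gen o (p 0)) \in rel.
  apply: relator_rel; have ab := admissible_prod b ao.
  have := relator_lin a ab (admissible_prod 0 ao).
  congr (relator g _); congr (gen _ _ - _); apply: funext => d.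
  by rewrite /p; ring.
(* With [a = 1] and [b = 0], the relator is the opposite of the generator with zero form. *)
have p0 : gen o (p 0) \in rel.
  by have := lin 1 0; rewrite mulr0 addr0 scale1r opprD addNKr rpredN.
have := lin c 1; rewrite mulr1 addr0 opprD addrA => h.
have -> : oriented o = gen o (p 1).
  by congr gen; apply: funext => d; rewrite /p mul1r.
by move: (rpredD h p0); rewrite subrK.
Qed.

Lemma gen_rel (G : graph n) (o : seq {set 'I_(nflag G)}) p :
  admissible g (@Generator iota_Com n G o p) ->
  gen o p - p (@unit_decor n G) *: oriented o \in rel.
Proof.
move=> [mG oG /= pL]; have := gen_scale (p (@unit_decor n G)) (conj mG oG).
by rewrite -(multilinearE pL).
Qed.

(** The size is a variable [m], so that permutations indexed by a number merely equal to [size o]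
    can be used without casts. *)
Lemma gen_iso (G H : graph n) (o : seq {set 'I_(nflag G)})
    (o' : seq {set 'I_(nflag H)}) fV fF m (s : 'S_m) :
  oadmissible o -> oadmissible o' -> graph_iso fV fF -> size o = m ->
  (forall i : 'I_m, nth set0 o' i = fF @: nth set0 o (s i)) ->
  oriented o' - (-1) ^+ s *: oriented o \in rel.
Proof.
move=> ao ao' iso em; case: m / em s => s os; apply: relator_rel.
apply: (relator_iso (fV := fV) (fF := fF)) => //.
- exact: admissible_prod1.
- exact: admissible_prod1.
- by move=> d; rewrite prod_form_iso.
Qed.

End Relators.

(** * Invariants of graphs with ordered edges *)

Lemma ext0 T m (t : T) (f : 'I_m -> T) : ext t f ord0 = t.
Proof. by rewrite /ext unlift_none. Qed.

Lemma extS T m (t : T) (f : 'I_m -> T) i : ext t f (lift ord0 i) = f i.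
Proof. by rewrite /ext liftK. Qed.

Lemma ext_fa T m (s t : T) (f : 'I_m -> T) : ext s (ext t f) (fa m) = s.
Proof. exact: ext0. Qed.

Lemma ext_fb T m (s t : T) (f : 'I_m -> T) : ext s (ext t f) (fb m) = t.
Proof. by rewrite extS ext0. Qed.

Lemma ext_fkeep T m (s t : T) (f : 'I_m -> T) x :
  ext s (ext t f) (fkeep x) = f x.
Proof. by rewrite !extS. Qed.

Definition extE := (ext_fa, ext_fb, ext_fkeep, ext0, extS).

Lemma fkeep_inj m : injective (@fkeep m).
Proof. by move=> x y /lift_inj/lift_inj. Qed.

Variant flag_spec m : 'I_m.+2 -> Type :=
| FlagA : flag_spec (fa m)
| FlagB : flag_spec (fb m)
| FlagKeep x : flag_spec (fkeep x).

Lemma flagP m (x : 'I_m.+2) : flag_spec x.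
Proof.
case: (unliftP ord0 x) => [y|] ->; last exact: FlagA.
by case: (unliftP ord0 y) => [z|] ->; [exact: FlagKeep | exact: FlagB].
Qed.

Lemma ext_bij m m' (f : 'I_m -> 'I_m') :
  bijective f -> bijective (ext ord0 (fun v => lift ord0 (f v))).
Proof.
case=> f' fK Kf; exists (ext ord0 (fun v => lift ord0 (f' v))) => x;
  by case: (unliftP ord0 x) => [y|] ->; rewrite !extE ?fK ?Kf.
Qed.

Definition flag_ext m m' (f : 'I_m -> 'I_m') : 'I_m.+2 -> 'I_m'.+2 :=
  ext (fa _) (ext (fb _) (fun x => fkeep (f x))).

Lemma flag_ext_bij m m' (f : 'I_m -> 'I_m') :
  bijective f -> bijective (flag_ext f).
Proof.
case=> f' fK Kf; exists (flag_ext f') => x;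
  by case: (flagP x) => [||y]; rewrite /flag_ext !extE ?fK ?Kf.
Qed.

Lemma new_order_iso n (G H : graph n) (fF : 'I_(nflag G) -> 'I_(nflag H))
    (o : seq {set 'I_(nflag G)}) (o' : seq {set 'I_(nflag H)}) m (s : 'S_m) :
  size o = m -> size o' = m ->
  (forall i : 'I_m, nth set0 o' i = fF @: nth set0 o (s i)) ->
  forall i : 'I_m.+1, nth set0 (new_order o') i =
    flag_ext fF @: nth set0 (new_order o) (lift_perm ord0 ord0 s i).
Proof.
move=> so so' os i; case: (unliftP ord0 i) => [j|] ->.
  rewrite lift_perm_lift /= !(nth_map set0) ?so ?so' ?ltn_ord // os -!imset_comp.
  by apply: eq_imset => x; rewrite /flag_ext /= extE.
by rewrite lift_perm_id /= imsetU !imset_set1 /flag_ext !extE.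
Qed.

Section IsoExpansion.
Variables (n : nat) (G H : graph n).
Variables (fV : 'I_(nvert G) -> 'I_(nvert H)) (fF : 'I_(nflag G) -> 'I_(nflag H)).
Hypothesis iso : graph_iso fV fF.

Lemma split_iso w P h :
  graph_iso (G := split_graph w P h) (H := split_graph (fV w) (fF @: P) h)
    (ext ord0 (fun v => lift ord0 (fV v))) (flag_ext fF).
Proof.
case: iso => -[bV bF] vE iE gE lE.
split; first by split; [apply: ext_bij | apply: flag_ext_bij].
- move=> x; case: (flagP x) => [||y]; rewrite /flag_ext /= !extE //.
  by rewrite mem_imset ?vE; [case: ifP; rewrite extE | exact: bij_inj].
- by move=> x; case: (flagP x) => [||y]; rewrite /flag_ext /= !extE ?iE.
- move=> v; case: (unliftP ord0 v) => [u|] -> /=; rewrite !extE //.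
  by rewrite gE (inj_eq (bij_inj bV)).
- by move=> i; rewrite /flag_ext /= !extE lE.
Qed.

Lemma loop_iso w :
  graph_iso (G := loop_graph w) (H := loop_graph (fV w)) fV (flag_ext fF).
Proof.
case: iso => -[bV bF] vE iE gE lE; split.
- by split=> //; apply: flag_ext_bij.
- by move=> x; case: (flagP x) => [||y]; rewrite /flag_ext /= !extE.
- by move=> x; case: (flagP x) => [||y]; rewrite /flag_ext /= !extE ?iE.
- by move=> v /=; rewrite gE (inj_eq (bij_inj bV)).
- by move=> i; rewrite /flag_ext /= !extE lE.
Qed.

Lemma iso_edges : edges H = [set fF @: (e : {set _}) | e in edges G].
Proof.
case: iso => -[_ [g gK Kg]] _ iE _ _.
apply/setP=> e; apply/imsetP/imsetP=> -[x].
  rewrite inE => xi ->; exists [set g x; Defs.inv (g x)].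
    by apply/imsetP; exists (g x) => //; rewrite inE -(inj_eq (can_inj gK)) -iE Kg.
  by rewrite imsetU !imset_set1 -iE Kg.
case/imsetP=> y; rewrite inE => yi -> ->; exists (fF y).
  by rewrite inE iE (inj_eq (can_inj gK)).
by rewrite imsetU !imset_set1 iE.
Qed.

Lemma card_iso_edges : #|edges H| = #|edges G|.
Proof.
case: iso => -[_ /bij_inj injF] _ _ _ _.
by rewrite iso_edges card_imset //; exact: imset_inj.
Qed.

End IsoExpansion.

(* Functions of a graph with ordered edges that descend to linear forms on the
   quotient by the relators. *)
Definition iso_invariant n
    (f : forall G : graph n, seq {set 'I_(nflag G)} -> rat) : Prop :=
  forall (G H : graph n) fV fF (o : seq {set 'I_(nflag G)})
      (o' : seq {set 'I_(nflag H)}) m (s : 'S_m),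
    graph_iso (G := G) (H := H) fV fF -> size o = m -> size o' = m ->
    (forall i : 'I_m, nth set0 o' i = fF @: nth set0 o (s i)) ->
    f H o' = (-1) ^+ s * f G o.

(** The transpose of the differential, acting on functions of graphs with ordered edges. *)
Definition codiff n (f : forall G : graph n, seq {set 'I_(nflag G)} -> rat)
    (G : graph n) (o : seq {set 'I_(nflag G)}) : rat :=
  2%:R^-1 * (\sum_(w < nvert G)
     \sum_(P : {set 'I_(nflag G)} | P \subset fl w)
     \sum_(h < (genus w).+1 |
             (3 <= 2 * h + #|P|.+1)%N &&
             (3 <= 2 * (genus w - h) + #|fl w :\: P|.+1)%N)
       f (split_graph w P h) (new_order o))
  + \sum_(w < nvert G | (0 < genus w)%N) f (loop_graph w) (new_order o).

(** An isomorphism extends to the expanded graphs and permutes the expansions. The new edge stays in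
    first place, so the extended permutation of the edges has the same sign. This takes the place of
    a proof that [diff] preserves the relators. *)
Lemma codiff_invariant n (f : forall G : graph n, seq {set 'I_(nflag G)} -> rat) :
  iso_invariant f -> iso_invariant (codiff f).
Proof.
move=> fI G H fV fF o o' m s iso so so' os.
have [[bV bF] vE _ gE _] := iso.
have injF := bij_inj bF.
have bP : bijective (fun P : {set 'I_(nflag G)} => fF @: P).
  case: (bF) => g gK Kg; exists (fun P : {set 'I_(nflag H)} => g @: P) => P;
    rewrite -imset_comp.
    by rewrite (eq_imset _ gK) imset_id.
  by rewrite (eq_imset _ Kg) imset_id.
have sgn : (-1) ^+ lift_perm ord0 ord0 s = (-1) ^+ s :> rat.
  by rewrite odd_lift_perm addbb.
rewrite /codiff mulrDr mulrCA; congr (_ * _ + _).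
  rewrite (reindex fV) /=; last exact: onW_bij.
  rewrite mulr_sumr; apply: eq_bigr => w _.
  rewrite (reindex (fun P : {set 'I_(nflag G)} => fF @: P)) /=;
    last exact: onW_bij.
  rewrite mulr_sumr; apply: eq_big => [P|P _].
    rewrite (iso_fl iso); apply/subsetP/subsetP => [h x xP|h _ /imsetP[x /h xP ->]].
      by rewrite -(mem_imset _ _ injF) h // imset_f.
    exact: imset_f.
  rewrite gE mulr_sumr; apply: eq_big => [h|h _].
    rewrite (iso_fl iso) card_imset //; congr (_ && (_ <= _ + _.+1)%N).
    by rewrite -[RHS](card_imset _ injF); congr #|pred_of_set _|; apply/setP=> y;
      case: (bF) => g gK Kg; rewrite -[y]Kg !inE !mem_imset // !inE.
  rewrite -sgn; apply: (fI _ _ _ _ _ _ _ _ (split_iso iso w P h)).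
  - by rewrite /= size_map so.
  - by rewrite /= size_map so'.
  - exact: new_order_iso.
rewrite (reindex fV) /=; last exact: onW_bij.
rewrite mulr_sumr; apply: eq_big => [w|w _]; first by rewrite gE.
rewrite -sgn; apply: (fI _ _ _ _ _ _ _ _ (loop_iso iso w)).
- by rewrite /= size_map so.
- by rewrite /= size_map so'.
- exact: new_order_iso.
Qed.

Section Functional.
Variables (n : nat) (f : forall G : graph n, seq {set 'I_(nflag G)} -> rat).
Local Notation C := (prechain iota_Com n).

(** By [multilinearE], the value at the unit decoration is the factor by which a form differs from
    [prod_form]. *)
Definition functional_gen (k : generator iota_Com n) : rat :=
  @f (gr k) (ord k) * Defs.form (@unit_decor n (gr k)).

Definition functional (x : C) : rat^o :=
  \sum_(k <- msupp x) x@_k * functional_gen k.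

Lemma functionalE (x : C) (D : {fset {classic generator iota_Com n}}) :
  (msupp x `<=` D)%fset -> functional x = \sum_(k <- D) x@_k * functional_gen k.
Proof.
move=> xD; apply: big_fset_incl => // k _ /mcoeff_outdom ->.
by rewrite mul0r.
Qed.

Lemma functional_linear : linear functional.
Proof.
move=> c x y.
pose D : {fset {classic generator iota_Com n}} :=
  (msupp (c *: x + y) `|` (msupp x `|` msupp y))%fset.
have [xD yD zD] : [/\ (msupp x `<=` D)%fset, (msupp y `<=` D)%fset &
                      (msupp (c *: x + y) `<=` D)%fset].
  by split; apply/fsubsetP => k kx; rewrite !inE kx ?orbT.
rewrite (functionalE xD) (functionalE yD) (functionalE zD) scaler_sumr -big_split.
apply: eq_bigr => k _ /=.
by rewrite mcoeffD mcoeffZ mulrDl -mulrA.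
Qed.

HB.instance Definition _ := GRing.isLinear.Build rat C rat^o *:%R functional
  functional_linear.

Lemma functional_U (G : graph n) (o : seq {set 'I_(nflag G)}) p :
  functional (gen o p) = f o * p (@unit_decor n G).
Proof.
rewrite (functionalE (D := [fset (Generator o p : {classic generator iota_Com n})]%fset)).
  by rewrite big_seq_fset1 mcoeffUU mul1r.
exact: msuppU_le.
Qed.

Lemma functional_rel g x :
  iso_invariant f -> x \in spanp (@relator iota_Com g n) -> functional x = 0.
Proof.
move=> fI /asboolP; elim=> [|c {}x y Rx _ IH]; first by rewrite linear0.
rewrite functional_linear IH addr0; suff -> : functional x = 0 by rewrite scaler0.
case: Rx => [G o {}c p q _ _|
  G H o o' p q fV fF s [_ [uo oE] _] [_ [uo' oE'] _] iso os pq].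
  rewrite linearB linearD linearZ /= !functional_U.
  apply/eqP; rewrite subr_eq0; apply/eqP.
  by rewrite [LHS]mulrDr mulrCA.
have so' : size o' = size o.
  by rewrite -(card_uniqP uo) -(card_uniqP uo') (eq_card oE) (eq_card oE')
    (card_iso_edges iso).
rewrite linearB linearZ /= !functional_U pq (unit_decor_iso iso).
rewrite (fI _ _ _ _ _ _ _ _ iso erefl so' os) -mulrA; exact: subrr.
Qed.

End Functional.

Lemma diff_gen_U n (G : graph n) (o : seq {set 'I_(nflag G)})
    (p : decor iota_Com G -> rat) :
  diff (gen o p) = diff_gen (Generator o p).
Proof.
rewrite (diffE (D := [fset (Generator o p : {classic generator iota_Com n})]%fset)).
  by rewrite big_seq_fset1 mcoeffUU scale1r.
exact: msuppU_le.
Qed.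

Lemma prechainE n (x : prechain iota_Com n) :
  x = \sum_(k <- msupp x) x@_k *: gen (ord k) (@Defs.form _ _ k).
Proof.
rewrite {1}[x]monalgE; apply: eq_bigr => k _.
case: k => G o p; apply/malgP=> k'.
by rewrite mcoeffZ !mcoeffU mulr_natr.
Qed.

(** * Contraction of the new edge *)

Lemma ord0_lift m (i : 'I_m) :
  ((ord0 == lift ord0 i) = false) * ((lift ord0 i == ord0) = false).
Proof.
by split; first rewrite (negPf (neq_lift _ _));
  rewrite // eq_sym (negPf (neq_lift _ _)).
Qed.

Lemma flag_eqE m (x y : 'I_m) :
  ((fkeep x == fkeep y) = (x == y)) *
  ((fkeep x == fa m) = false) * ((fa m == fkeep x) = false) *
  ((fkeep x == fb m) = false) * ((fb m == fkeep x) = false).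
Proof. by rewrite !(inj_eq lift_inj) !ord0_lift. Qed.

Lemma fa_fb m : ((fa m == fb m) = false) * ((fb m == fa m) = false).
Proof. by rewrite !ord0_lift. Qed.

Lemma mem_fkeep m (A : {set 'I_m}) (x : 'I_m) :
  (fkeep x \in @fkeep m @: A) = (x \in A).
Proof. exact: mem_imset (@fkeep_inj _). Qed.

Lemma fa_notin_fkeep m (A : {set 'I_m}) : (fa m \in @fkeep m @: A) = false.
Proof. by apply/imsetP=> -[x _] /eqP; rewrite ord0_lift. Qed.

Lemma fb_notin_fkeep m (A : {set 'I_m}) : (fb m \in @fkeep m @: A) = false.
Proof. by apply/imsetP=> -[x _] /eqP; rewrite (inj_eq lift_inj) ord0_lift. Qed.

Definition flagE := (flag_eqE, fa_fb, mem_fkeep, fa_notin_fkeep, fb_notin_fkeep,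
  ord0_lift).

Section Contraction.
Variables (n : nat) (G : graph n) (w : 'I_(nvert G)).

Lemma split_fl (P : {set 'I_(nflag G)}) h v : v != w -> P \subset fl w ->
  fl (G := split_graph w P h) (lift ord0 v) = @fkeep _ @: fl v.
Proof.
move=> vw Pw; apply/setP=> x; rewrite inE.
case: (flagP x) => [||y]; rewrite /= !(extE, flagE) ?(inj_eq lift_inj).
- by rewrite eq_sym (negPf vw).
- by [].
rewrite inE; case: ifP => [yP|_]; rewrite ?(inj_eq lift_inj) //.
have := subsetP Pw _ yP; rewrite inE => /eqP ->.
by rewrite ord0_lift eq_sym (negPf vw).
Qed.

Lemma split_fl_glue (P : {set 'I_(nflag G)}) h : P \subset fl w ->
  (fl (G := split_graph w P h) (lift ord0 w) :\ fa _)
    :|: (fl (G := split_graph w P h) ord0 :\ fb _) = @fkeep _ @: fl w.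
Proof.
move=> Pw; apply/setP=> x; rewrite !in_setU !in_setD1 !(in_set (fun x => _ == _)).
case: (flagP x) => [||y]; rewrite /= !(extE, flagE) ?eqxx //=.
rewrite inE; case: ifP => [yP|_].
  by have := subsetP Pw _ yP; rewrite inE => ->; rewrite eqxx orbT.
by rewrite (inj_eq lift_inj) ord0_lift orbF.
Qed.

Lemma loop_fl v : v != w ->
  fl (G := loop_graph w) v = @fkeep _ @: fl v.
Proof.
move=> vw; apply/setP=> x; rewrite inE.
by case: (flagP x) => [||y]; rewrite /= !(extE, flagE) 1?eq_sym ?(negPf vw) ?inE.
Qed.

Lemma loop_fl_glue :
  fl (G := loop_graph w) w :\ fa _ :\ fb _ = @fkeep _ @: fl w.
Proof.
apply/setP=> x; rewrite !in_setD1 in_set.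
by case: (flagP x) => [||y]; rewrite /= !(extE, flagE) ?eqxx ?inE.
Qed.

(** The point is that no [coe] takes its default value 0: the genera of the two halves add up
    because [h <= genus w], and their flags reunite because [P] consists of flags at [w]. *)
Lemma contract_splitE (P : {set 'I_(nflag G)}) h
    (d : decor iota_Com (split_graph w P h)) :
  P \subset fl w -> (h <= genus w)%N ->
  contract_split d = (fun v => if v == w then value d (lift ord0 v) * value d ord0
                               else value d (lift ord0 v)).
Proof.
move=> Pw hw; apply: funext => v; rewrite /contract_split.
case: ifPn => [/eqP -> | vw].
  apply: icom_coe; last exact: split_fl_glue.
  by rewrite /= !extE eqxx subnK.
by apply: icom_coe; rewrite ?split_fl //= extE (negPf vw).
Qed.

Lemma contract_loopE (d : decor iota_Com (loop_graph w)) :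
  (0 < genus w)%N -> contract_loop d = value d.
Proof.
move=> hw; apply: funext => v; rewrite /contract_loop.
case: ifPn => [/eqP -> | vw].
  apply: icom_coe; last exact: loop_fl_glue.
  by rewrite /= eqxx prednK.
by apply: icom_coe; rewrite ?loop_fl //= (negPf vw).
Qed.

Lemma unit_contract_split (P : {set 'I_(nflag G)}) h :
  P \subset fl w -> (h <= genus w)%N ->
  contract_split (@unit_decor n (split_graph w P h)) = @unit_decor n G.
Proof.
move=> Pw hw; rewrite contract_splitE //; apply: funext => v.
by case: ifP; rewrite /value /unit_decor // => _; exact: mulr1.
Qed.

Lemma unit_contract_loop :
  (0 < genus w)%N -> contract_loop (@unit_decor n (loop_graph w)) = @unit_decor n G.
Proof. by move=> hw; rewrite contract_loopE. Qed.

Lemma prod_contract_split (P : {set 'I_(nflag G)}) h :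
  P \subset fl w -> (h <= genus w)%N ->
  (fun d => prod_form (contract_split d)) = @prod_form n (split_graph w P h).
Proof.
move=> Pw hw; apply: funext => d; rewrite contract_splitE //.
rewrite /prod_form big_ord_recl /= (bigD1 w) //= [in RHS](bigD1 w) //=.
rewrite {1}/value eqxx mulrA [X in X * _ = _]mulrC; congr (_ * _).
by apply: eq_bigr => v /negPf vw; rewrite {1}/value vw.
Qed.

Lemma prod_contract_loop : (0 < genus w)%N ->
  (fun d => prod_form (contract_loop d)) = @prod_form n (loop_graph w).
Proof. by move=> hw; apply: funext => d; rewrite contract_loopE. Qed.

End Contraction.

Section FunctionalDiff.
Variables (n : nat) (f : forall G : graph n, seq {set 'I_(nflag G)} -> rat).

Lemma functional_diff (x : prechain iota_Com n) :
  functional f (diff x) = functional (codiff f) x.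
Proof.
rewrite {1}(prechainE x) (linear_sum (@diff iota_Com n)) (linear_sum (functional f)).
apply: eq_bigr => k _; rewrite linearZ linearZ; congr (_ * _).
case: k => G o p; rewrite /= diff_gen_U /diff_gen /functional_gen /codiff /=.
rewrite linearD linearZ mulrDl; congr (_ + _).
  rewrite -mulrA linear_sum mulr_suml; congr (_ * _); apply: eq_bigr => w _.
  rewrite linear_sum mulr_suml; apply: eq_bigr => P Pw.
  rewrite linear_sum mulr_suml; apply: eq_bigr => h _.
  by rewrite /= functional_U unit_contract_split // -ltnS.
rewrite linear_sum mulr_suml; apply: eq_bigr => w w0.
by rewrite /= functional_U unit_contract_loop.
Qed.

End FunctionalDiff.

(* The sign of the Vandermonde determinant of the entries of s: it vanishes if
   s has repetitions, and is antisymmetric. *)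
Fixpoint vsign (s : seq nat) : int :=
  if s is x :: s' then foldr *%R 1 [seq sgz (y%:Z - x%:Z) | y <- s'] * vsign s'
  else 1.

Lemma vsignE (s : seq nat) :
  vsign s = sgz (\det (Vandermonde (size s) (\row_(i < size s) (nth 0%N s i)%:Z))).
Proof.
have prodE m (F : 'I_m -> int) (P : pred 'I_m) :
    sgz (\prod_(i < m | P i) F i) = \prod_(i < m | P i) sgz (F i).
  by elim/big_rec2: _ => [|i a b _ <-]; rewrite ?sgz1 ?sgzM.
rewrite det_Vandermonde prodE.
elim: s => [|x s IH] /=; first by rewrite big_ord0.
rewrite big_ord_recl IH; congr (_ * _).
  rewrite foldrE big_map prodE (big_nth 0%N) big_mkord.
  rewrite [RHS]big_mkcond big_ord_recl ltnn /= mul1r.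
  by apply: eq_bigr => i _; rewrite /= !mxE.
apply: eq_bigr => i _; rewrite !prodE [RHS]big_mkcond big_ord_recl /= mul1r big_mkcond.
by apply: eq_bigr => j _; rewrite !mxE.
Qed.

Lemma vsign_perm (s s' : seq nat) m (t : 'S_m) :
  size s = m -> size s' = m ->
  (forall i : 'I_m, nth 0%N s' i = nth 0%N s (t i)) ->
  vsign s' = (-1) ^+ t * vsign s.
Proof.
move=> ss ss' st; rewrite !vsignE ss ss'.
have -> : Vandermonde m (\row_(i < m) (nth 0%N s' i)%:Z) =
    col_perm t (Vandermonde m (\row_(i < m) (nth 0%N s i)%:Z)).
  by apply/matrixP=> i j; rewrite !mxE st.
rewrite col_permE det_mulmx det_perm sgzM odd_permV mulrC.
by case: (odd_perm t); rewrite ?expr1 ?expr0 ?sgzN ?sgz1.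
Qed.

Lemma perm_eq_map_enum (T T' : finType) (f : T -> T') :
  bijective f -> perm_eq (map f (enum T)) (enum T').
Proof.
move=> bf; apply: uniq_perm; rewrite ?enum_uniq //.
  by rewrite map_inj_uniq ?enum_uniq //; exact: bij_inj.
move=> y; rewrite mem_enum; apply/mapP.
by case: bf => g _ Kg; exists (g y); rewrite ?mem_enum.
Qed.

Lemma perm_eq_nth (T : eqType) (x0 : T) (s s' : seq T) m (t : 'S_m) :
  size s = m -> size s' = m ->
  (forall i : 'I_m, nth x0 s' i = nth x0 s (t i)) -> perm_eq s' s.
Proof.
have nthE (r : seq T) : size r = m -> r = [seq nth x0 r (i : 'I_m) | i <- enum 'I_m].
  by move=> <-; rewrite -{1}(mkseq_nth x0 r) /mkseq -val_enum_ord -map_comp.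
move=> es es' st; rewrite (nthE s es) (nthE s' es').
rewrite (eq_map (g := (fun i : 'I_m => nth x0 s i) \o t)); last exact: st.
by rewrite map_comp; apply: perm_map; apply: perm_eq_map_enum; exists (t^-1)%g;
  [exact: permK | exact: permKV].
Qed.

(** * Signed counts of isomorphisms onto a fixed graph *)

Section Detector.
Variables (n N : nat) (tv : seq (nat * nat)) (te : seq nat).

(** In base 3, an edge has two digits 1, or one digit 2 if its ends have the same colour; the number
    thus determines the unordered pair of colours. *)
Definition colour_edge (G : graph n) (s : {ffun 'I_(nvert G) -> 'I_N})
  (e : {set 'I_(nflag G)}) : nat := \sum_(x in e) 3 ^ s (vtx x).

Definition colour_genera (G : graph n) (s : {ffun 'I_(nvert G) -> 'I_N}) :
  seq (nat * nat) := [seq (s v : nat, genus v) | v <- enum 'I_(nvert G)].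

(* With N colours, a colouring s with [perm_eq (colour_genera s) tv] and
   [perm_eq (map (colour_edge s) o) te] is an isomorphism onto the graph
   described by tv (pairs of a vertex and its genus) and te (an edge {u, v}
   being encoded by 3^u + 3^v). *)
Definition detector (G : graph n) (o : seq {set 'I_(nflag G)}) : rat :=
  (\sum_(s : {ffun 'I_(nvert G) -> 'I_N} |
         perm_eq (colour_genera s) tv && perm_eq (map (colour_edge s) o) te)
     vsign (map (colour_edge s) o))%:~R.

(** Colourings are pulled back along the isomorphism. Both conditions ignore the order of the lists,
    so that only [vsign] sees the permutation of the edges. *)
Lemma detector_invariant : iso_invariant detector.
Proof.
move=> G H fV fF o o' m t iso so so' os.
have [[bV bF] vE _ gE _] := iso.
rewrite /detector -[(-1) ^+ t](rmorph_sign (intmul (1 : rat))) -rmorphM; congr (_%:~R).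
pose pull (s : {ffun 'I_(nvert H) -> 'I_N}) : {ffun 'I_(nvert G) -> 'I_N} :=
  [ffun v => s (fV v)].
have pull_bij : bijective pull.
  case: (bV) => g gK Kg.
  exists (fun s : {ffun 'I_(nvert G) -> 'I_N} =>
    [ffun v => s (g v)] : {ffun 'I_(nvert H) -> 'I_N}) => s;
    by apply/ffunP=> v; rewrite !ffunE ?gK ?Kg.
have edgeE (s : {ffun 'I_(nvert H) -> 'I_N}) (e : {set 'I_(nflag G)}) :
    colour_edge s (fF @: e) = colour_edge (pull s) e.
  rewrite /colour_edge big_imset /=; last by move=> x y _ _; exact: bij_inj.
  by apply: eq_bigr => x _; rewrite ffunE vE.
have nthE (s : {ffun 'I_(nvert H) -> 'I_N}) (i : 'I_m) :
    nth 0%N (map (colour_edge s) o') i =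
    nth 0%N (map (colour_edge (pull s)) o) (t i).
  by rewrite !(nth_map set0) ?so ?so' ?ltn_ord // os edgeE.
rewrite (reindex pull) /=; last exact: onW_bij.
rewrite mulr_sumr; apply: eq_big => [s|s _].
  congr (_ && _).
    suff /permPl -> : perm_eq (colour_genera s) (colour_genera (pull s)) by [].
    have -> : colour_genera (pull s) =
        [seq (s v : nat, genus v) | v <- map fV (enum 'I_(nvert G))].
      by rewrite -map_comp; apply: eq_map => v; rewrite /= ffunE gE.
    by apply: perm_map; rewrite perm_sym; exact: perm_eq_map_enum.
  have /permPl -> // : perm_eq (map (colour_edge s) o') (map (colour_edge (pull s)) o).
  by apply: perm_eq_nth (nthE s); rewrite size_map.
by apply: vsign_perm; rewrite ?size_map.
Qed.

End Detector.

(** * Graphs encoded by sequences *)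

(* Vertex genera and pairs of end points of the edges. *)
Definition code : Type := (seq nat * seq (nat * nat))%type.

(* Flags 2i and 2i + 1 are the two halves of edge number i. *)
Definition endpoint (es : seq (nat * nat)) (x : nat) : nat :=
  let e := nth (0, 0)%N es x./2 in if odd x then e.2 else e.1.

Definition no_ord (T : Type) (i : 'I_0) : T.
Proof. by case: i. Defined.

Lemma half_lt m (x : 'I_m.*2) : (x./2 < m)%N.
Proof. by rewrite ltn_half_double. Qed.

Lemma mkflag_lt m (i : 'I_m) (b : bool) : (b + (i : nat).*2 < m.*2)%N.
Proof. by case: b i => -[i im] /=; lia. Qed.

Definition edge_of m (x : 'I_m.*2) : 'I_m := Ordinal (half_lt x).
Definition mkflag m (i : 'I_m) (b : bool) : 'I_m.*2 := Ordinal (mkflag_lt i b).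

Lemma mkflagK m (x : 'I_m.*2) : mkflag (edge_of x) (odd x) = x.
Proof. by apply: val_inj; rewrite /= odd_double_half. Qed.

Lemma edge_of_mkflag m (i : 'I_m) b : edge_of (mkflag i b) = i.
Proof. by apply: val_inj; rewrite /= half_bit_double. Qed.

Lemma odd_mkflag m (i : 'I_m) b : odd (mkflag i b) = b.
Proof. by rewrite /= oddD odd_double addbF; case: b. Qed.

Arguments edge_of : simpl never.
Arguments mkflag : simpl never.

(** The successor makes [inord] available; it sends an end point out of range to vertex 0, whence
    the hypothesis [in_range] in what follows. *)
Definition std_graph (k m : nat) (gs ends : nat -> nat) : graph 0 :=
  @Graph 0 k.+1 m.*2 (fun x => inord (ends x))
    (fun x => mkflag (edge_of x) (~~ odd x)) (fun v => gs v) (@no_ord _).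

Definition std_order (m : nat) : seq {set 'I_m.*2} :=
  [seq [set x | edge_of x == i] | i <- enum 'I_m].

Lemma size_std_order m : size (std_order m) = m.
Proof. by rewrite size_map size_enum_ord. Qed.

Lemma nth_std_order m (i : 'I_m) :
  nth set0 (std_order m) i = [set x | edge_of x == i].
Proof. by rewrite (nth_map i) ?size_enum_ord // nth_ord_enum. Qed.

Lemma uniq_std_order m : uniq (std_order m).
Proof.
rewrite map_inj_uniq ?enum_uniq // => i j /setP/(_ (mkflag i false)).
by rewrite !inE edge_of_mkflag eqxx => /esym/eqP.
Qed.

Section StdGraph.
Variables (k m : nat) (gs ends : nat -> nat).
Local Notation G := (std_graph k m gs ends).

Lemma std_invE (x : 'I_m.*2) :
  @Defs.inv 0 G x = mkflag (edge_of x) (~~ odd x).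
Proof. by []. Qed.

Lemma std_invK : involutive (@Defs.inv 0 G).
Proof.
by move=> x; rewrite !std_invE edge_of_mkflag odd_mkflag negbK; exact: mkflagK.
Qed.

Lemma std_inv_neq (x : 'I_m.*2) : @Defs.inv 0 G x != x.
Proof.
apply/eqP=> /(congr1 (fun x : 'I_m.*2 => odd x)).
by rewrite std_invE odd_mkflag; case: odd.
Qed.

Lemma std_edge (x : 'I_m.*2) :
  [set x; @Defs.inv 0 G x] = [set y | edge_of y == edge_of x].
Proof.
apply/setP=> y; rewrite !inE std_invE; apply/orP/eqP=> [[/eqP -> //|/eqP ->]|yx].
  by rewrite edge_of_mkflag.
have [e|e] := eqVneq (odd y) (odd x).
  by left; rewrite -(mkflagK y) yx e mkflagK.
right; rewrite -(mkflagK y) yx; have -> // : odd y = ~~ odd x.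
by case: (odd y) (odd x) e => -[].
Qed.

Lemma std_order_edges : std_order m =i edges G.
Proof.
move=> e; apply/mapP/imsetP=> [[i _ ->]|[x _ ->]].
  exists (mkflag i false); first by rewrite inE std_inv_neq.
  by rewrite std_edge edge_of_mkflag.
by exists (edge_of x); rewrite ?mem_enum // std_edge.
Qed.

Lemma card_std_edges : #|edges G| = m.
Proof.
by rewrite -(eq_card std_order_edges) (card_uniqP (uniq_std_order m)) size_std_order.
Qed.

End StdGraph.

Lemma modular_noleg (G : graph 0) g : modular_type G g ->
  forall x, @Defs.inv 0 G x != x.
Proof.
move=> [[_ _ H] _ _ _] x; apply/eqP=> /H[i _]; exact: (no_ord _ i).
Qed.

(** A locally constant function is constant along paths; conversely, the component of [u] defines
    such a function. This criterion transfers along isomorphisms and, for boolean values, is decided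
    by enumeration. *)
Lemma connected_cutP n (G : graph n) : involutive (@Defs.inv n G) ->
  (forall u v, connect (@adj n G) u v) <->
  (forall b : 'I_(nvert G) -> bool,
     (forall x, b (vtx x) = b (vtx (Defs.inv x))) -> forall u v, b u = b v).
Proof.
move=> iK; split=> [conn b bE u v|cut u v].
  have /connectP[p] := conn u v.
  elim: p u => [|w p IH] u /=; first by move=> _ ->.
  by move=> /andP[/existsP[x /andP[/eqP <- /eqP <-]] /IH h /h <-].
have := cut (connect (@adj n G) u) _ u v; rewrite connect0 => <- // x.
apply/idP/idP => /connect_trans; apply; apply: connect1; apply/existsP.
  by exists x; rewrite !eqxx.
by exists (Defs.inv x); rewrite iK !eqxx.
Qed.

Lemma n_comp_connected n (G : graph n) : involutive (@Defs.inv n G) ->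
  (0 < nvert G)%N -> (forall u v, connect (@adj n G) u v) ->
  n_comp (@adj n G) predT = 1%N.
Proof.
move=> iK n0 conn; pose x : 'I_(nvert G) := Ordinal n0.
rewrite -(n_comp_connect (e := @adj n G) _ x); last by move=> u v; rewrite !conn.
by apply: eq_n_comp_r => v; rewrite !inE /=; apply/esym/conn.
Qed.

Lemma sum_card_fl n (G : graph n) : (\sum_v #|@fl n G v|)%N = nflag G.
Proof.
rewrite -[RHS]card_ord -sum1_card (partition_big (@vtx n G) predT) //=.
by apply: eq_bigr => v _; rewrite sum1_card cardsE.
Qed.

Lemma modular_type_iso n (G H : graph n) fV fF g :
  graph_iso (G := G) (H := H) fV fF -> modular_type G g -> modular_type H g.
Proof.
move=> iso [[iK lI iL] [n0 conn] stab gen].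
have [[bV bF] vE iE gE lE] := iso; have [fF' FK KF] := bF.
have [fV' VK KV] := bV.
have nV : nvert H = nvert G by have := bij_eq_card bV; rewrite !card_ord.
have iK' : involutive (@Defs.inv n H).
  by move=> y; rewrite -[y]KF !iE iK.
have conn' : forall u v, connect (@adj n H) u v.
  apply/connected_cutP => // b bE u v; rewrite -[u]KV -[v]KV.
  apply: (proj1 (connected_cutP iK) conn (b \o fV)) => x /=.
  by rewrite -!vE bE -iE.
split.
- split=> //; first by move=> i j; rewrite -!lE => /(can_inj FK)/lI.
  move=> y; rewrite -[y]KF iE; split=> [/(can_inj FK)/iL[i <-]|[i]].
    by exists i; rewrite lE.
  by rewrite -lE => /(can_inj FK) e; congr fF; apply/iL; exists i.
- by split=> //; rewrite nV.
- by move=> v; rewrite -[v]KV gE (iso_fl iso) card_imset //; exact: can_inj FK.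
rewrite -[RHS]gen; congr (_ + _)%N.
  by rewrite /betti1 (card_iso_edges iso) !n_comp_connected ?nV // nV.
rewrite (reindex fV) /=; last exact: onW_bij.
by apply: eq_bigr => v _; rewrite gE.
Qed.

Lemma graph_iso_sym n (G H : graph n) fV fF fV' fF' :
  graph_iso (G := G) (H := H) fV fF -> cancel fV fV' -> cancel fV' fV ->
  cancel fF fF' -> cancel fF' fF -> graph_iso (G := H) (H := G) fV' fF'.
Proof.
move=> [_ vE iE gE lE] VK KV FK KF; split.
- by split; [exists fV | exists fF].
- by move=> x; rewrite -[x in RHS]KF vE VK.
- by move=> x; rewrite -[x in RHS]KF iE FK.
- by move=> v; rewrite -[v in RHS]KV gE.
- by move=> i; rewrite -lE FK.
Qed.

Fixpoint words (T : Type) (s : seq T) (n : nat) : seq (seq T) :=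
  if n is n'.+1 then [seq x :: w | x <- s, w <- words s n'] else [:: [::]].

Lemma mem_words (T : eqType) (s : seq T) n w :
  (w \in words s n) = (size w == n) && all [in s] w.
Proof.
elim: n w => [|n IH] [|x w] //=; first by apply/allpairsP=> -[[y v] []].
rewrite eqSS andbCA -IH; apply/allpairsP/andP=> [[[y v] /= [ys vw [-> ->]]]|[xs ww]].
  by [].
by exists (x, w).
Qed.

Lemma uniq_words (T : eqType) (s : seq T) n : uniq s -> uniq (words s n).
Proof.
move=> us; elim: n => //= n IH; apply: allpairs_uniq => //.
by move=> [x v] [y w] _ _ [-> ->].
Qed.

Definition incident (es : seq (nat * nat)) (v : nat) : seq nat :=
  [seq x <- iota 0 (size es).*2 | endpoint es x == v].

Definition in_range (c : code) : bool :=
  all (fun e => (e.1 < size c.1)%N && (e.2 < size c.1)%N) c.2.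

(* Connectedness, stated as the triviality of the locally constant functions
   with boolean values. *)
Definition code_connected (c : code) : bool :=
  all (fun b => all (fun e => nth false b e.1 == nth false b e.2) c.2 ==> constant b)
    (words [:: false; true] (size c.1)).

(* Stable connected graphs of genus 3. *)
Definition valid (c : code) : bool :=
  let n := size c.1 in
  [&& (0 < n)%N, in_range c,
      (n <= (size c.2).+1)%N && (size c.2 + sumn c.1 == n + 2)%N,
      all (fun v => 3 <= 2 * nth 0 c.1 v + size (incident c.2 v))%N (iota 0 n) &
      code_connected c].

Definition code_graph (c : code) : graph 0 :=
  std_graph (size c.1).-1 (size c.2) (nth 0%N c.1) (endpoint c.2).

Lemma endpoint_lt c x : in_range c -> (x < (size c.2).*2)%N ->
  (endpoint c.2 x < size c.1)%N.
Proof.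
move=> /allP cr xm; rewrite /endpoint.
have /cr/andP[] : nth (0, 0)%N c.2 x./2 \in c.2.
  by apply: mem_nth; rewrite ltn_half_double.
by case: ifP.
Qed.

Lemma endpoint_bit es i (b : bool) :
  endpoint es (b + i.*2) =
  if b then (nth (0, 0)%N es i).2 else (nth (0, 0)%N es i).1.
Proof. by rewrite /endpoint half_bit_double oddD odd_double addbF; case: b. Qed.

Lemma code_vtx c (x : 'I_(size c.2).*2) : (0 < size c.1)%N -> in_range c ->
  @vtx 0 (code_graph c) x = endpoint c.2 x :> nat.
Proof.
by move=> n0 cr; rewrite /= inordK // prednK // endpoint_lt.
Qed.

Lemma card_code_fl c (v : 'I_(size c.1).-1.+1) : (0 < size c.1)%N -> in_range c ->
  #|@fl 0 (code_graph c) v| = size (incident c.2 v).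
Proof.
move=> n0 cr; rewrite size_filter -val_enum_ord count_map cardsE cardE size_filter.
rewrite -enumT; apply: eq_count => x.
by rewrite /= unfold_in /= -[in RHS](code_vtx x n0 cr).
Qed.

Lemma code_connectedP c : (0 < size c.1)%N -> in_range c ->
  reflect (forall u v, connect (@adj 0 (code_graph c)) u v) (code_connected c).
Proof.
move=> n0 cr; have nk := prednK n0.
have edgeP (f : nat -> bool) :
   (forall x, f (@vtx 0 (code_graph c) x) = f (vtx (Defs.inv x))) <->
   all (fun e => f e.1 == f e.2) c.2.
  split=> [fE|/(all_nthP (0, 0)%N) fE x].
    apply/(all_nthP (0, 0)%N) => i im; have := fE (mkflag (Ordinal im) false).
    rewrite std_invE edge_of_mkflag odd_mkflag !code_vtx //.
    by rewrite !endpoint_bit => /= ->.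
  have := fE (edge_of x) (ltn_ord _); rewrite std_invE !code_vtx // endpoint_bit.
  by rewrite [endpoint _ x]/endpoint; case: odd => /= /eqP ->.
have iK : involutive (@Defs.inv 0 (code_graph c)) by exact: std_invK.
have ordn (i : 'I_(size c.1).-1.+1) : (i < size c.1)%N.
  exact: leq_trans (ltn_ord i) (eq_leq nk).
apply: (equivP _ (iff_sym (connected_cutP iK))).
apply: (iffP allP) => [cc b bE u v|cc w].
  pose w := mkseq (fun i => b (inord i)) (size c.1).
  have wE (i : 'I_(size c.1).-1.+1) : nth false w i = b i.
    by rewrite nth_mkseq ?inord_val.
  have ww : w \in words [:: false; true] (size c.1).
    by rewrite mem_words size_mkseq eqxx; apply/allP=> -[].
  have := cc w ww; rewrite (proj1 (edgeP (nth false w))); last first.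
    by move=> x; rewrite !wE.
  move=> /(constantP false)[i wi]; rewrite -!wE wi !nth_nseq.
  by rewrite size_mkseq !ordn.
rewrite mem_words => /andP[/eqP sw _]; apply/implyP=> wE.
have := cc (fun v => nth false w v) (proj2 (edgeP _) wE).
move=> wc; apply/(constantP false); exists (nth false w 0).
apply: (@eq_from_nth _ false); rewrite ?size_nseq // sw => i ilt.
rewrite nth_nseq ilt.
by have := wc (inord i) (inord 0); rewrite !inordK // nk.
Qed.

Lemma code_sum_genus c : (0 < size c.1)%N ->
  (\sum_(v < nvert (code_graph c)) genus v = sumn c.1)%N.
Proof. by move=> n0; rewrite sumnE (big_nth 0%N) big_mkord -[in RHS](prednK n0). Qed.

(** The sum of the stability conditions over all vertices; each edge contributes two flags. *)
Lemma code_stable c : (0 < size c.1)%N -> in_range c ->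
  (forall v : 'I_(nvert (code_graph c)), 3 <= 2 * genus v + #|fl v|)%N ->
  (size c.1 * 3 <= 2 * sumn c.1 + (size c.2).*2)%N.
Proof.
move=> n0 cr st; have nk := prednK n0.
have : (\sum_(v < nvert (code_graph c)) 3 <=
        \sum_(v < nvert (code_graph c)) (2 * genus v + #|fl v|))%N.
  by apply: leq_sum => v _; exact: st.
rewrite sum_nat_const card_ord big_split -big_distrr code_sum_genus // sum_card_fl.
by rewrite -{1}nk.
Qed.

Lemma valid_modular c : (0 < size c.1)%N -> in_range c ->
  reflect (modular_type (code_graph c) 3) (valid c).
Proof.
move=> n0 cr; have nk := prednK n0.
have iK := @std_invK (size c.1).-1 (size c.2) (nth 0%N c.1) (endpoint c.2).
have sumE := code_sum_genus n0.
have stabP :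
    reflect (forall v : 'I_(nvert (code_graph c)), (3 <= 2 * genus v + #|fl v|)%N)
      (all (fun v => 3 <= 2 * nth 0 c.1 v + size (incident c.2 v))%N
        (iota 0 (size c.1))).
  apply: (iffP allP) => st v.
    rewrite card_code_fl // st // mem_iota.
    exact: leq_trans (ltn_ord v) (eq_leq nk).
  rewrite mem_iota /= -{1}nk => vn.
  by have := st (Ordinal vn); rewrite card_code_fl.
rewrite /valid n0 cr /=.
apply: (iffP and3P) =>
    [[/andP[nm /eqP ge] /stabP st /code_connectedP conn]|[_ [_ conn] st ge]].
  have {}conn := conn n0 cr.
  split=> //.
    split=> //; first by case.
    move=> x; split=> [/eqP|[i]]; last exact: no_ord.
    by rewrite (negPf (std_inv_neq _ _ _ x)).
  by rewrite /betti1 n_comp_connected // card_std_edges sumE /= nk; lia.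
have conn' : code_connected c by apply/code_connectedP.
have st' := introT stabP st; split=> //.
have st3 := code_stable n0 cr st.
move: ge; rewrite /betti1 n_comp_connected // card_std_edges sumE /= nk => ge.
(* The subtraction in [betti1] is truncated. Were it to truncate strictly, the labels would sum to
   3, and stability would leave only two vertices without edges, which are not connected. *)
suff nm : (size c.1 <= (size c.2).+1)%N by rewrite nm /=; lia.
rewrite leqNgt; apply/negP=> nm.
have [n2 m0] : size c.1 = 2 /\ size c.2 = 0 by lia.
have := proj1 (connected_cutP iK) conn (fun v => v == 0%N :> nat) _ (inord 0) (inord 1).
rewrite !inordK ?nk ?n2 // => h; suff : true = false by []; apply: h => x.
have x0 : (x < (size c.2).*2)%N := ltn_ord x.
by exfalso; move: x0; rewrite {2}m0.
Qed.

(** * Reduction to normal forms *)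

Section Eqmod.
Variables g n : nat.
Local Notation C := (prechain iota_Com n).

Definition eqmod (x y : C) : bool := x - y \in spanp (@relator iota_Com g n).

Lemma eqmod_refl x : eqmod x x.
Proof. by rewrite /eqmod subrr rpred0. Qed.

Lemma eqmod_sym x y : eqmod x y -> eqmod y x.
Proof. by rewrite /eqmod -opprB rpredN. Qed.

Lemma eqmod_trans y x z : eqmod x y -> eqmod y z -> eqmod x z.
Proof. by rewrite /eqmod => xy yz; rewrite -(subrK y x) -addrA rpredD. Qed.

Lemma eqmodD x y x' y' : eqmod x y -> eqmod x' y' -> eqmod (x + x') (y + y').
Proof. by rewrite /eqmod => xy xy'; rewrite opprD addrACA rpredD. Qed.

Lemma eqmodZ c x y : eqmod x y -> eqmod (c *: x) (c *: y).
Proof. by rewrite /eqmod => xy; rewrite -scalerBr rpredZ. Qed.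

Lemma eqmod_sum (I : Type) (r : seq I) (P : pred I) (F F' : I -> C) :
  (forall i, P i -> eqmod (F i) (F' i)) ->
  eqmod (\sum_(i <- r | P i) F i) (\sum_(i <- r | P i) F' i).
Proof.
move=> h; elim/big_rec2: _ => [|i x y Pi]; first exact: eqmod_refl.
by move=> xy; apply: eqmodD => //; exact: h.
Qed.

End Eqmod.

Local Notation "x =~ y" := (eqmod 3 (x : prechain iota_Com 0) y) (at level 70).

Definition code_class (c : code) : prechain iota_Com 0 :=
  @oriented 0 (code_graph c) (std_order (size c.2)).

Lemma code_admissible c : valid c ->
  @oadmissible 3 0 (code_graph c) (std_order (size c.2)).
Proof.
move=> vc; have /and5P[n0 cr _ _ _] := vc; split; first exact/valid_modular.
by split; [exact: uniq_std_order | exact: std_order_edges].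
Qed.

(** The common source of all moves on codes: [t] sends the vertices of [c'] to those of [c], [s]
    matches the edges and [b] marks those to be reversed. Validity of [c'] is part of the conclusion
    so that moves can be chained. *)
Lemma code_class_iso (c c' : code) (t : nat -> nat) m (s : 'S_m) (b : nat -> bool) :
  valid c -> in_range c' -> size c'.1 = size c.1 ->
  size c.2 = m -> size c'.2 = m ->
  (forall v, v < size c.1 -> t v < size c.1)%N ->
  (forall u v, u < size c.1 -> v < size c.1 -> t u = t v -> u = v)%N ->
  (forall v, v < size c.1 -> nth 0 c.1 (t v) = nth 0 c'.1 v)%N ->
  (forall i : 'I_m, nth (0, 0)%N c.2 (s i) =
     let e := nth (0, 0)%N c'.2 i in if b i then (t e.2, t e.1) else (t e.1, t e.2)) ->
  valid c' /\ code_class c =~ (-1) ^+ s *: code_class c'.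
Proof.
move=> vc cr' n' em em'; case: m / em' em s => em s tlt tinj gE eE.
have /and5P[n0 cr _ _ _] := vc.
have n0' : (0 < size c'.1)%N by rewrite n'.
have nk := prednK n0; have nk' : (size c'.1).-1.+1 = size c.1 by rewrite prednK.
pose ci := cast_ord (esym em).
pose fV (v : 'I_(size c'.1).-1.+1) : 'I_(size c.1).-1.+1 := inord (t v).
pose fF (x : 'I_(size c'.2).*2) : 'I_(size c.2).*2 :=
  mkflag (ci (s (edge_of x))) (odd x (+) b (edge_of x)).
have ltV (v : 'I_(size c'.1).-1.+1) : (v < size c.1)%N.
  exact: leq_trans (ltn_ord v) (eq_leq nk').
have fVE v : fV v = t v :> nat by rewrite inordK // nk tlt.
have bV : bijective fV.
  apply: inj_card_bij; last by rewrite !card_ord nk nk'.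
  move=> u v /(congr1 (@nat_of_ord _)); rewrite !fVE => /tinj h.
  by apply: val_inj; apply: h.
have bF : bijective fF.
  apply: inj_card_bij; last by rewrite !card_ord em.
  move=> x y xy; rewrite -(mkflagK x) -(mkflagK y).
  have := congr1 (@edge_of _) xy; rewrite !edge_of_mkflag.
  move=> /cast_ord_inj/perm_inj exy.
  have := congr1 (fun z : 'I__ => odd z) xy; rewrite !odd_mkflag exy.
  by move/addIb=> ->.
have iso : graph_iso (G := code_graph c') (H := code_graph c) fV fF.
  split=> //.
  - move=> x; apply: val_inj; apply: etrans (code_vtx (fF x) n0 cr) _.
    apply: esym; apply: etrans (fVE _) _; rewrite code_vtx // endpoint_bit eE.
    by rewrite /endpoint; case: odd => /=; case: (b _).
  - move=> x; rewrite std_invE edge_of_mkflag odd_mkflag.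
    by rewrite [@Defs.inv _ _ x]std_invE /fF edge_of_mkflag odd_mkflag addNb.
  - by move=> v; rewrite /= fVE gE.
  - by move=> i; exact: no_ord.
have vc' : valid c'.
  apply/valid_modular => //; case: (bV) (bF) => fV' VK KV [fF' FK KF].
  by apply: modular_type_iso (graph_iso_sym iso VK KV FK KF) _; apply/valid_modular.
(* The isomorphism runs from [c'] to [c], whereas [s] sends positions in [c'] to positions in [c];
   hence the inverse. *)
split=> //; rewrite -odd_permV; apply: (gen_iso _ _ iso (m := size c'.2)).
- exact: code_admissible.
- exact: code_admissible.
- exact: size_std_order.
move=> i; rewrite nth_std_order (nth_std_order (ci i)).
apply/setP=> y; case: (bF) => fF' FK KF.
rewrite -[y]KF mem_imset; last exact: can_inj FK.
rewrite !inE edge_of_mkflag (inj_eq (@cast_ord_inj _ _ _)).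
by rewrite -[in RHS](inj_eq (@perm_inj _ s)) permKV.
Qed.

Local Notation "x =~ y" := (eqmod 3 (x : prechain iota_Com 0) y) (at level 70).
(* z : int * code stands for the multiple z.1 of the class of z.2 *)
Definition reduces (c : code) (z : int * code) : Prop :=
  valid c -> valid z.2 /\ code_class c =~ z.1%:~R *: code_class z.2.

Lemma reduces_refl c : reduces c (1, c).
Proof. by move=> vc; split=> //; rewrite scale1r eqmod_refl. Qed.

Lemma reduces_trans c y z :
  reduces c y -> reduces y.2 z -> reduces c (y.1 * z.1, z.2).
Proof.
move=> cy yz /cy[/yz[vz yz'] cy']; split; first exact: vz.
apply: eqmod_trans cy' _; rewrite rmorphM -scalerA; exact: eqmodZ.
Qed.

Lemma reduces_swap gs pre e f s :
  reduces (gs, pre ++ e :: f :: s) (-1, (gs, pre ++ f :: e :: s)).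
Proof.
move=> vc; have /and5P[_ cr _ _ _] := vc.
have i_lt : (size pre < size (pre ++ e :: f :: s))%N by rewrite size_cat /=; lia.
have j_lt : ((size pre).+1 < size (pre ++ e :: f :: s))%N by rewrite size_cat /=; lia.
pose i := Ordinal i_lt; pose j := Ordinal j_lt.
have j_pre : ((size pre).+1 < size pre)%N = false by lia.
have ij : i != j by rewrite -val_eqE /=; lia.
have := @code_class_iso _ (gs, pre ++ f :: e :: s) id _ (tperm i j) (fun=> false) vc _
  erefl erefl.
rewrite odd_tperm ij rmorphN1; apply=> //.
- by move: cr; rewrite /in_range /= !all_cat /= [X in _ && X]andbCA.
- by rewrite /= !size_cat.
move=> k /=; rewrite -surjective_pairing.
case: tpermP => [->|->|/eqP ki /eqP kj] /=; rewrite !nth_cat /=.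
- by rewrite j_pre ltnn subnn subSnn.
- by rewrite j_pre ltnn subnn subSnn.
move: ki kj; rewrite -!val_eqE /=; case: ltnP => // pk ki kj.
by have -> : (k - size pre = (k - (size pre).+2).+2)%N by lia.
Qed.

Lemma eqmod_opp0 (x : prechain iota_Com 0) : x =~ - x -> x =~ 0.
Proof.
rewrite /eqmod opprK subr0 => xx.
have -> : x = 2%:R^-1 *: (x + x).
  by rewrite -mulr2n -[X in _ *: X]scaler_nat scalerA mulVf ?scale1r.
exact: rpredZ.
Qed.

Definition lex (e f : nat * nat) : bool :=
  (e.1 < f.1)%N || (e.1 == f.1) && (e.2 < f.2)%N.

(** Insertion sort that keeps track of the sign. The coefficient 0 marks a repeated edge: exchanging
    the two copies gives the same code with sign -1. With a non-zero coefficient the order obtained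
    is strict. *)
Fixpoint insert_edge (e : nat * nat) (s : seq (nat * nat)) :
    int * seq (nat * nat) :=
  if s is f :: s' then
    if lex e f then (1, e :: s) else
    if e == f then (0, e :: s) else
    let r := insert_edge e s' in (- r.1, f :: r.2)
  else (1, [:: e]).

Lemma reduces_insert gs pre e s :
  reduces (gs, pre ++ e :: s)
    ((insert_edge e s).1, (gs, pre ++ (insert_edge e s).2)).
Proof.
elim: s pre => [|f s IH] pre /=; first exact: reduces_refl.
case: ifP => _; first exact: reduces_refl.
case: eqP => [->|_].
  move=> vc; split=> //; rewrite scale0r; apply: eqmod_opp0.
  by have [_] := reduces_swap vc; rewrite rmorphN1 scaleN1r.
have := reduces_trans (@reduces_swap gs pre e f s); rewrite /= -cat_rcons => /(_ _ (IH _)).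
by rewrite mulN1r cat_rcons.
Qed.

Definition orient (e : nat * nat) : nat * nat := (minn e.1 e.2, maxn e.1 e.2).

(** Only permutations of edges carry signs; reversing an edge is free. *)
Lemma reduces_orient gs s : reduces (gs, s) (1, (gs, map orient s)).
Proof.
move=> vc; have /and5P[_ cr _ _ _] := vc.
have := @code_class_iso _ (gs, map orient s) id _ 1%g
  (fun i => let e := nth (0, 0)%N s i in e.2 < e.1)%N vc _ erefl erefl.
rewrite odd_perm1; apply=> //.
- apply/allP=> _ /mapP[e /(allP cr)/= /andP[e1 e2] ->] /=.
  by rewrite !gtn_max gtn_min e1 e2.
- by rewrite size_map.
move=> i /=; rewrite perm1 (nth_map (0, 0)%N) // /orient.
by case: (nth _ _ _) => a b /=; rewrite /minn /maxn; case: ltngtP => // ->.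
Qed.

Fixpoint sort_edges (s : seq (nat * nat)) : int * seq (nat * nat) :=
  if s is e :: s' then
    let r := sort_edges s' in
    let r' := insert_edge e r.2 in (r.1 * r'.1, r'.2)
  else (1, [::]).

Lemma reduces_sort gs pre s :
  reduces (gs, pre ++ s) ((sort_edges s).1, (gs, pre ++ (sort_edges s).2)).
Proof.
elim: s pre => [|e s IH] pre; first exact: reduces_refl.
have := IH (rcons pre e); rewrite !cat_rcons => h.
exact: reduces_trans h (@reduces_insert gs pre e _).
Qed.

Definition normalize (c : code) : int * code :=
  let r := sort_edges (map orient c.2) in (r.1, (c.1, r.2)).

Lemma reduces_norm c : reduces c (normalize c).
Proof.
case: c => gs s; have := reduces_trans (@reduces_orient gs s) (@reduces_sort gs [::] _).
by rewrite mul1r.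
Qed.

(* t lists the images of the vertices *)
Definition relabel (t : seq nat) (c : code) : code :=
  ([seq nth 0%N c.1 (index v t) | v <- iota 0 (size c.1)],
   [seq (nth 0 t e.1, nth 0 t e.2)%N | e <- c.2]).

Lemma reduces_relabel t c :
  perm_eq t (iota 0 (size c.1)) -> reduces c (1, relabel t c).
Proof.
move=> tn vc; have /and5P[_ cr _ _ _] := vc.
have st : size t = size c.1 by rewrite (perm_size tn) size_iota.
have mt v : (v \in t) = (v < size c.1)%N by rewrite (perm_mem tn) mem_iota.
have ut : uniq t by rewrite (perm_uniq tn) iota_uniq.
have := @code_class_iso _ (relabel t c) (index^~ t) _ 1%g (fun=> false) vc _ _ erefl.
rewrite odd_perm1; apply=> //.
- apply/allP=> _ /mapP[e /(allP cr)/= /andP[e1 e2] ->] /=.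
  by rewrite size_map size_iota -!mt !mem_nth ?st.
- by rewrite size_map size_iota.
- by rewrite size_map.
- by move=> v vn; rewrite -[X in (_ < X)%N]st index_mem mt.
- by move=> u v un vn uv; rewrite -(nth_index 0%N (_ : u \in t)) ?mt // uv nth_index ?mt.
- by move=> v vn; rewrite (nth_map 0%N) ?size_iota // nth_iota.
move=> i /=; rewrite perm1 (nth_map (0, 0)%N) //=.
have /(allP cr)/andP[e1 e2] : nth (0, 0)%N c.2 i \in c.2 by exact: mem_nth.
by rewrite !index_uniq ?st // -surjective_pairing.
Qed.

Definition code_orbit (c : code) : seq (int * code) :=
  [seq normalize (relabel t c) | t <- permutations (iota 0 (size c.1))].

Lemma reduces_code_orbit c z : z \in code_orbit c -> reduces c z.
Proof.
case/mapP=> t; rewrite mem_permutations => tn ->.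
have := reduces_trans (reduces_relabel tn) (@reduces_norm (relabel t c)).
by rewrite mul1r -surjective_pairing.
Qed.

(* The classes with e > 0 edges are entries 2e - 1 and 2e.  Entry 2e + 1 arises
   from entry 2e, for e < 6, by trading genus for a loop; the last entry is the
   complete graph on 4 vertices. *)
Definition reps : seq code := [::
  ([:: 3], [::]);
  ([:: 2], [:: (0,0)]);
  ([:: 1; 2], [:: (0,1)]);
  ([:: 0; 2], [:: (0,0); (0,1)]);
  ([:: 1; 1], [:: (0,1); (1,1)]);
  ([:: 0; 1], [:: (0,0); (0,1); (1,1)]);
  ([:: 1; 1; 0], [:: (0,1); (0,2); (2,2)]);
  ([:: 0; 1; 0], [:: (0,0); (0,1); (0,2); (2,2)]);
  ([:: 1; 0; 0], [:: (0,1); (0,2); (1,1); (2,2)]);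
  ([:: 0; 0; 0], [:: (0,0); (0,1); (0,2); (1,1); (2,2)]);
  ([:: 0; 1; 0; 0], [:: (0,1); (0,2); (0,3); (2,2); (3,3)]);
  ([:: 0; 0; 0; 0], [:: (0,1); (0,2); (0,3); (1,1); (2,2); (3,3)]);
  ([:: 0; 0; 0; 0], [:: (0,1); (0,2); (0,3); (1,2); (1,3); (2,3)])]%N.

(* An odd automorphism of c makes its class vanish. *)
Definition nf (c : code) : int * code :=
  let c1 := normalize c in
  let rs := code_orbit c1.2 in
  if (-1, c1.2) \in rs then (0, c1.2) else
  let r := nth (1, c1.2) rs (find (fun r => r.2 \in reps) rs) in
  (c1.1 * r.1, r.2).

Lemma reduces_nf c : reduces c (nf c).
Proof.
rewrite /nf; case: ifP => [odd_aut|_].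
  have h : reduces (normalize c).2 (0, (normalize c).2).
    move=> vc; split=> //; rewrite scale0r; apply: eqmod_opp0.
    by have [_] := reduces_code_orbit odd_aut vc; rewrite rmorphN1 scaleN1r.
  by have := reduces_trans (@reduces_norm c) h; rewrite mulr0.
apply: reduces_trans; first exact: reduces_norm.
set i := find _ _; have [i_lt|i_ge] := ltnP i (size (code_orbit (normalize c).2)).
  by apply: reduces_code_orbit; exact: mem_nth.
by rewrite nth_default //; exact: reduces_refl.
Qed.

(** * Classification of the stable graphs of genus 3 *)

Lemma mem_mask_lex (P s : seq (nat * nat)) :
  sorted lex P -> sorted lex s -> {subset s <= P} ->
  s \in [seq mask b P | b <- words [:: false; true] (size P)].
Proof.
have lex_trans : transitive lex by move=> [a b] [c d] [e f]; rewrite /lex /=; lia.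
have lex_irr : irreflexive lex by move=> [a b]; rewrite /lex /=; lia.
move=> sP ss sub; apply/mapP; exists [seq x \in s | x <- P].
  by rewrite mem_words size_map eqxx; apply/allP=> -[].
rewrite -filter_mask; apply: (irr_sorted_eq lex_trans lex_irr) => //.
  exact: sorted_filter.
by move=> x; rewrite mem_filter andb_idr // => /sub.
Qed.

Local Notation "x =~ y" := (eqmod 3 (x : prechain iota_Com 0) y) (at level 70).
Lemma perm_insert_edge e s : perm_eq (insert_edge e s).2 (e :: s).
Proof.
elim: s => //= f s IH; case: ifP => // _; case: ifP => // _ /=.
by apply/seq.permP=> a; have /seq.permP/(_ a) /= := IH; lia.
Qed.

Lemma perm_sort_edges s : perm_eq (sort_edges s).2 s.
Proof.
elim: s => //= e s IH; apply: perm_trans (perm_insert_edge _ _) _.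
by rewrite perm_cons.
Qed.

Lemma lex_total e f : ~~ lex e f -> e != f -> lex f e.
Proof. by case: e f => [a b] [a' b']; rewrite /lex xpair_eqE /=; lia. Qed.

Lemma path_insert_edge e f s :
  lex f e -> (insert_edge e s).1 != 0 -> path lex f s -> path lex f (insert_edge e s).2.
Proof.
elim: s f => [|g s IH] f /= fe; first by rewrite fe.
case: ifP => [eg _ /andP[_ ps]|eg]; first by rewrite /= fe eg.
case: ifP => //= eg'.
rewrite oppr_eq0 => r0 /andP[-> ps] /=; apply: IH => //.
by apply: lex_total; rewrite ?eg ?eg'.
Qed.

Lemma sorted_sort_edges s : (sort_edges s).1 != 0 -> sorted lex (sort_edges s).2.
Proof.
elim: s => //= e s IH; rewrite mulf_eq0 negb_or => /andP[/IH].
case: (sort_edges s).2 => //= f s' ps.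
case: ifP => [ef|ef]; first by rewrite /= ef.
case: ifP => //= ef'.
rewrite oppr_eq0 => r0; apply: path_insert_edge => //.
by apply: lex_total; rewrite ?ef ?ef'.
Qed.

Definition pairs (n : nat) : seq (nat * nat) :=
  [seq (i, j) | i <- iota 0 n, j <- iota i (n - i)].

(** Sorted edge lists without repetition are the masks of [pairs n]. The last condition is the genus
    formula for a connected graph of genus 3. *)
Definition all_codes (n : nat) : seq code :=
  [seq c <- [seq (gs, mask b (pairs n)) | gs <- words (iota 0 4) n,
             b <- words [:: false; true] (size (pairs n))]
    | size c.2 + sumn c.1 == n + 2]%N.

Definition classified (c : code) : bool :=
  let rs := code_orbit c in ((-1, c) \in rs) || has (fun r => r.2 \in reps) rs.

(* [if] rather than [==>], both arguments of which vm_compute would evaluate. *)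
Lemma all_codes_classified :
  all (fun n => all (fun c => if valid c then classified c else true) (all_codes n))
    [:: 1; 2; 3; 4]%N.
Proof. by vm_compute. Qed.

Lemma valid_classified c :
  valid c -> all (fun e => e.1 <= e.2)%N c.2 -> sorted lex c.2 -> classified c.
Proof.
move=> vc oc sc; have /and5P[n0 cr /andP[nm /eqP ge] _ _] := vc.
have [_ [_ _] st _] : modular_type (code_graph c) 3 by exact/valid_modular.
(* With [n] vertices, labels and edges together contribute [n + 2], so that stability reads
   [3n <= 2n + 4]. *)
have n4 : (size c.1 <= 4)%N by have := code_stable n0 cr st; lia.
have n14 : size c.1 \in [:: 1; 2; 3; 4]%N by rewrite !inE; lia.
have /allP/(_ c) := allP all_codes_classified _ n14.
rewrite vc; apply; rewrite mem_filter ge eqxx /=.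
have /mapP[b bw eb] : c.2 \in [seq mask b (pairs (size c.1)) |
    b <- words [:: false; true] (size (pairs (size c.1)))].
  apply: mem_mask_lex => // [|e ec].
    by move: n14; rewrite !inE => /or4P[] /eqP ->.
  have /andP[e1 e2] := allP cr _ ec; have /= e12 := allP oc _ ec.
  apply/allpairsPdep; exists e.1, e.2; rewrite !mem_iota -surjective_pairing.
  by split=> //; rewrite e12 subnKC ?(ltnW e1).
apply/allpairsP; exists (c.1, b); split=> //=; last by rewrite -eb -surjective_pairing.
rewrite mem_words eqxx; apply/allP=> v vc1. rewrite /= !inE.
(* A connected graph has at least [n - 1] edges, which leaves at most 3 for the sum of the genus
   labels. *)
have : (v <= sumn c.1)%N.
  by move: vc1; elim: (c.1) => //= u s IH; rewrite inE => /orP[/eqP ->|/IH]; lia.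
lia.
Qed.

Lemma nf_classified c : valid c -> (nf c).1 = 0 \/ (nf c).2 \in reps.
Proof.
move=> vc; have [nc0|nc0] := eqVneq (normalize c).1 0.
  left; rewrite /nf; case: ifP => // _.
  exact: etrans (congr1 (fun z => z * _) nc0) (mul0r _).
have [vn _] := reduces_norm vc.
have on : all (fun e => e.1 <= e.2)%N (normalize c).2.2.
  apply/allP=> e; rewrite /= (perm_mem (perm_sort_edges _)) => /mapP[f _ ->] /=.
  by rewrite geq_min !leq_max leqnn.
have := valid_classified vn on (sorted_sort_edges nc0).
rewrite /classified /nf; case: ifP => [_ _|_ /= hr]; first by left.
by right; have := nth_find (1, (normalize c).2) hr.
Qed.

(** * Encoding of arbitrary graphs *)

Definition same_code (G : graph 0) (o : seq {set 'I_(nflag G)}) (c : code) : Prop :=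
  [/\ valid c, size c.2 = size o & oriented o =~ code_class c].

Lemma oadmissible_iso n g (G H : graph n) fV fF (o : seq {set 'I_(nflag G)})
    (o' : seq {set 'I_(nflag H)}) :
  graph_iso (G := G) (H := H) fV fF -> size o' = size o ->
  (forall i, (i < size o)%N -> nth set0 o' i = fF @: nth set0 o i) ->
  oadmissible g o' -> oadmissible g o.
Proof.
move=> iso so oE [mH [uo' o'E]].
have [[[fV' VK KV] [fF' FK KF]] _ _ _ _] := iso.
have injF : injective (fun A : {set 'I_(nflag G)} => fF @: A).
  exact/imset_inj/(can_inj FK).
have oE' : o' = [seq fF @: (A : {set 'I_(nflag G)}) | A <- o].
  apply: (@eq_from_nth _ set0); rewrite ?size_map // so => i i_lt.
  by rewrite oE // (nth_map set0).
split; first exact: modular_type_iso (graph_iso_sym iso VK KV FK KF) mH.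
split; first by move: uo'; rewrite oE' map_inj_uniq.
move=> e; rewrite -(mem_map injF) -oE' o'E (iso_edges iso).
exact: mem_imset.
Qed.

(** A choice of one half [h i] of every edge numbers the flags in pairs, in the given order of the
    edges. Without legs every flag belongs to an edge, so all flags are numbered. *)
Lemma code_of_graph (G : graph 0) (o : seq {set 'I_(nflag G)}) :
  oadmissible 3 o -> exists c, same_code o c.
Proof.
move=> ao; have [mG [uo oE]] := ao; have noleg := modular_noleg mG.
have [[iK _ _] [n0 _] _ _] := mG.
have [h hE] : exists h : 'I_(size o) -> 'I_(nflag G),
    forall i : 'I_(size o), nth set0 o i = [set h i; Defs.inv (h i)].
  apply: (fin_all_exists (P := fun (i : 'I_(size o)) y =>
    nth set0 o i = [set y; Defs.inv y])) => i.
  have : nth set0 o i \in edges G by rewrite -oE mem_nth.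
  by case/imsetP=> y _ ->; exists y.
pose gs := [seq genus v | v <- enum 'I_(nvert G)].
pose es := [seq (vtx (h i) : nat, vtx (Defs.inv (h i)) : nat) | i <- enum 'I_(size o)].
have ngs : size gs = nvert G by rewrite size_map size_enum_ord.
have nes : size es = size o by rewrite size_map size_enum_ord.
pose c : code := (gs, es); have c0 : (0 < size c.1)%N by rewrite ngs.
have nk : (size gs).-1.+1 = nvert G by rewrite prednK.
have cr : in_range c.
  by apply/allP=> _ /mapP[i _ ->]; rewrite /= ngs !ltn_ord.
have esE (i : 'I_(size es)) : nth (0, 0)%N es i =
    (vtx (h (cast_ord nes i)) : nat, vtx (Defs.inv (h (cast_ord nes i))) : nat).
  by rewrite (nth_map (cast_ord nes i)) ?size_enum_ord -?nes //
    (nth_ord_enum _ (cast_ord nes i)).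
pose fV : 'I_(size gs).-1.+1 -> 'I_(nvert G) := cast_ord nk.
pose fF (x : 'I_(size es).*2) : 'I_(nflag G) :=
  let y := h (cast_ord nes (edge_of x)) in if odd x then Defs.inv y else y.
have fF_edge x : nth set0 o (edge_of x) = [set fF x; Defs.inv (fF x)].
  have := hE (cast_ord nes (edge_of x)); rewrite /fF => ->.
  by case: odd; rewrite // iK setUC.
have fF_inj : injective fF.
  move=> x y xy; rewrite -(mkflagK x) -(mkflagK y).
  have exy : edge_of x = edge_of y.
    apply: val_inj; apply/eqP; rewrite -(nth_uniq set0 _ _ uo) -?nes ?ltn_ord //.
    by rewrite !fF_edge xy.
  rewrite exy; congr mkflag; move: xy; rewrite /fF exy.
  have ne := noleg (h (cast_ord nes (edge_of y))).
  by case: (odd x) (odd y) => -[] //= /eqP; rewrite ?(negPf ne) // eq_sym (negPf ne).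
have [fF' KF] : exists fF', forall y, fF (fF' y) = y.
  apply: (fin_all_exists (P := fun y x => fF x = y)) => y.
  have : [set y; Defs.inv y] \in o by rewrite oE; apply/imsetP; exists y; rewrite ?inE.
  move=> /(nthP set0)[i i_lt ei].
  have i_lt' : (i < size es)%N by rewrite nes.
  have : y \in nth set0 o (Ordinal i_lt') by rewrite ei !inE eqxx.
  rewrite (hE (cast_ord nes (Ordinal i_lt'))) !inE => /orP[] /eqP ->.
    by exists (mkflag (Ordinal i_lt') false); rewrite /fF odd_mkflag edge_of_mkflag.
  by exists (mkflag (Ordinal i_lt') true); rewrite /fF odd_mkflag edge_of_mkflag.
have iso : graph_iso (G := code_graph c) (H := G) fV fF.
  split.
  - split; first by exists (cast_ord (esym nk)); [exact: cast_ordK | exact: cast_ordKV].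
    by exists fF' => // x; apply: fF_inj; rewrite KF.
  - move=> x; apply: val_inj; apply: esym; apply: etrans (code_vtx x c0 cr) _.
    rewrite /endpoint [nth _ _ _](esE (edge_of x)) /fF.
    by case: odd.
  - move=> x; rewrite std_invE /fF edge_of_mkflag odd_mkflag.
    by case: odd => /=; rewrite ?iK.
  - move=> v; rewrite /= (nth_map (fV v)) ?size_enum_ord -?nk //.
    by congr genus; apply: val_inj; rewrite /= nth_enum_ord // -nk.
  - by move=> i; exact: no_ord.
have ordE i : (i < size (std_order (size es)))%N ->
    nth set0 o i = fF @: nth set0 (std_order (size es)) i.
  rewrite size_std_order => i_lt; pose j := Ordinal i_lt.
  rewrite (nth_std_order j) -(edge_of_mkflag j false).
  rewrite -(@std_edge (size gs).-1 _ (nth 0%N gs) (endpoint es)) imsetU !imset_set1.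
  have [_ _ <- _ _] := iso; rewrite -fF_edge edge_of_mkflag //.
have so : size o = size (std_order (size es)) by rewrite size_std_order.
have aoc := oadmissible_iso iso so ordE ao.
exists c; split=> //; first by apply/valid_modular => //; case: aoc.
have := gen_iso (s := 1%g : 'S_(size es)) aoc ao iso (size_std_order _).
rewrite odd_perm1 scale1r; apply=> i; rewrite perm1; apply: ordE.
by rewrite size_std_order.
Qed.

Local Notation "x =~ y" := (eqmod 3 (x : prechain iota_Com 0) y) (at level 70).
(** * The differential of an encoded graph *)

Definition edges_of (m : nat) (f : nat -> nat) : seq (nat * nat) :=
  mkseq (fun i => (f i.*2, f i.*2.+1)) m.

Lemma endpoint_edges_of m f x : (x < m.*2)%N -> endpoint (edges_of m f) x = f x.
Proof.
move=> xm; rewrite /endpoint nth_mkseq ?ltn_half_double //.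
by rewrite -[x in RHS]odd_double_half; case: odd.
Qed.

Lemma endpoint_cons e s x : endpoint (e :: s) x.+2 = endpoint s x.
Proof. by rewrite /endpoint /= negbK. Qed.

(* The vertex w is split, the flags selected by the mask b and the genus h going
   to a new vertex, number 0. *)
Definition split_code (c : code) (w : nat) (b : seq bool) (h : nat) : code :=
  (h :: mkseq (fun v => if v == w then nth 0 c.1 v - h else nth 0 c.1 v)%N (size c.1),
   (w.+1, 0)%N :: edges_of (size c.2)
     (fun x => if nth false b x then 0%N else (endpoint c.2 x).+1)).

Definition loop_code (c : code) (w : nat) : code :=
  (mkseq (fun v => if v == w then (nth 0 c.1 v).-1 else nth 0 c.1 v)%N (size c.1),
   (w, w) :: c.2).

Definition split_stable (c : code) (w : nat) (b : seq bool) (h : nat) : bool :=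
  (3 <= 2 * h + (count id b).+1)%N &&
  (3 <= 2 * (nth 0 c.1 w - h) + (size (incident c.2 w) - count id b).+1)%N.

Definition mask_at (c : code) (w : nat) (b : seq bool) : bool :=
  all (fun x => nth false b x ==> (endpoint c.2 x == w)) (iota 0 (size c.2).*2).

Definition splittings (c : code) : seq code :=
  flatten [seq
    flatten [seq
      [seq split_code c w b h | h <- iota 0 (nth 0%N c.1 w).+1 & split_stable c w b h]
      | b <- words [:: false; true] (size c.2).*2 & mask_at c w b]
    | w <- iota 0 (size c.1)].

Definition loopings (c : code) : seq code :=
  [seq loop_code c w | w <- iota 0 (size c.1) & (0 < nth 0 c.1 w)%N].

Definition mask_set m (b : seq bool) : {set 'I_m} := [set x : 'I_m | nth false b x].

Lemma sum_mask_set (V : nmodType) m (F : {set 'I_m} -> V) :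
  \sum_P F P = \sum_(b <- words [:: false; true] m) F (mask_set m b).
Proof.
rewrite -(big_map (mask_set m) predT F); apply: perm_big; apply: uniq_perm.
- exact: index_enum_uniq.
- rewrite map_inj_in_uniq ?uniq_words // => b b'.
  rewrite !mem_words => /andP[/eqP sb _] /andP[/eqP sb' _] /setP bb'.
  apply: (@eq_from_nth _ false); rewrite ?sb ?sb' // => i im.
  by have := bb' (Ordinal im); rewrite !inE.
move=> P; rewrite mem_index_enum; apply/esym/mapP.
exists (mkseq (fun i => [exists x : 'I_m, (x == i :> nat) && (x \in P)]) m).
  by rewrite mem_words size_mkseq eqxx; apply/allP=> -[].
apply/setP=> x; rewrite inE nth_mkseq //; apply/idP/existsP=> [xP|[y]].
  by exists x; rewrite eqxx.
by move=> /andP[/eqP/val_inj ->].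
Qed.

Lemma mem_new_std_order k m gs ends i (z : 'I_m.*2.+2) : (i < m.+1)%N ->
  (z \in nth set0 (new_order (G := std_graph k m gs ends) (std_order m)) i) =
  (z./2 == i).
Proof.
case: i => [_|i im] /=.
  by rewrite !inE; case: (flagP z) => [||y]; rewrite ?flagE ?eqxx.
rewrite (nth_map set0) ?size_std_order // (nth_std_order (Ordinal (im : (i < m)%N))).
by case: (flagP z) => [||y]; rewrite ?flagE // inE -val_eqE.
Qed.

Section ExpandCode.
Variables (c : code) (w : 'I_(size c.1).-1.+1).
Hypotheses (n0 : (0 < size c.1)%N) (cr : in_range c).

Let wn : (w < size c.1)%N.
Proof. exact: leq_trans (ltn_ord w) (eq_leq (prednK n0)). Qed.

Lemma split_in_range b h : in_range (split_code c w b h).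
Proof.
rewrite /in_range /= size_mkseq ltnS wn /=; apply/allP=> e /(nthP (0, 0)%N)[i].
rewrite size_mkseq => im <-; rewrite nth_mkseq //=.
have ltE x : (x < (size c.2).*2)%N ->
    ((if nth false b x then 0 else (endpoint c.2 x).+1) < (size c.1).+1)%N.
  by move=> xm; case: ifP => // _; rewrite ltnS endpoint_lt.
by rewrite !ltE //; lia.
Qed.

Lemma loop_in_range : in_range (loop_code c w).
Proof. by rewrite /in_range /= size_mkseq wn /=. Qed.

(** The flags [fa] and [fb] have numbers 0 and 1, the halves of edge 0, and [fkeep] adds 2, which
    moves every old edge up by one place. The identity on numbers is therefore an isomorphism. *)
Lemma split_code_iso b h eV eF :
  graph_iso (G := split_graph (G := code_graph c) w (mask_set _ b) h)
    (H := code_graph (split_code c w b h)) (cast_ord eV) (cast_ord eF).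
Proof.
split.
- split; [exists (cast_ord (esym eV)) | exists (cast_ord (esym eF))];
    by [exact: cast_ordK | exact: cast_ordKV].
- move=> x; apply: val_inj.
  apply: etrans (code_vtx _ _ (split_in_range b h)) _ => //.
  case: (flagP x) => [||y]; rewrite /= !extE //=.
  rewrite endpoint_cons endpoint_edges_of // inE; case: ifP => //= _.
  by rewrite inordK ?prednK ?endpoint_lt.
- move=> x; apply: val_inj; rewrite std_invE.
  case: (flagP x) => [||y]; rewrite /= !extE //=.
  by rewrite add0n negbK doubleS !addnS.
- move=> v; case: (unliftP ord0 v) => [u|] -> /=; rewrite !extE //=.
  rewrite nth_mkseq //; exact: leq_trans (ltn_ord u) (eq_leq (prednK n0)).
- by move=> i; exact: no_ord.
Qed.

Lemma loop_code_iso eV eF :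
  graph_iso (G := loop_graph (G := code_graph c) w)
    (H := code_graph (loop_code c w)) (cast_ord eV) (cast_ord eF).
Proof.
split.
- split; [exists (cast_ord (esym eV)) | exists (cast_ord (esym eF))];
    by [exact: cast_ordK | exact: cast_ordKV].
- move=> x; apply: val_inj.
  apply: etrans (code_vtx _ _ loop_in_range) _; first by rewrite size_mkseq.
  case: (flagP x) => [||y]; rewrite /= !extE //=.
  by rewrite endpoint_cons inordK ?prednK ?endpoint_lt.
- move=> x; apply: val_inj; rewrite std_invE.
  case: (flagP x) => [||y]; rewrite /= !extE //=.
  by rewrite add0n negbK doubleS !addnS.
- move=> v /=; rewrite nth_mkseq //.
  exact: leq_trans (ltn_ord v) (eq_leq (prednK n0)).
- by move=> i; exact: no_ord.
Qed.

End ExpandCode.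

Local Notation "x =~ y" := (eqmod 3 (x : prechain iota_Com 0) y) (at level 70).
(** No sign arises: flag numbers are preserved, and in both orders edge [i] consists of the flags
    [2i] and [2i + 1]. *)
Lemma expand_class m (c' : code) (G : graph 0) (o : seq {set 'I_(nflag G)}) fV
    (fF : 'I_(nflag G) -> 'I_(size c'.2).*2) :
  valid c' -> graph_iso (G := G) (H := code_graph c') fV fF ->
  size c'.2 = m -> size o = m -> (forall x, fF x = x :> nat) ->
  (forall i (z : 'I_(nflag G)), (i < m)%N -> (z \in nth set0 o i) = (z./2 == i)) ->
  oriented o =~ code_class c'.
Proof.
move=> vc' iso sc' so fFE oE.
have ordE i : (i < size o)%N ->
    nth set0 (std_order (size c'.2)) i = fF @: nth set0 o i.
  rewrite so => im; have im' : (i < size c'.2)%N by rewrite sc'.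
  have [[_ [g gK Kg]] _ _ _ _] := iso.
  rewrite (nth_std_order (Ordinal im')); apply/setP=> x.
  by rewrite -[x]Kg mem_imset ?oE ?inE -?val_eqE /= ?fFE //; exact: can_inj gK.
have soc' : size (std_order (size c'.2)) = size o by rewrite size_std_order sc'.
have aoc' := code_admissible vc'.
apply: eqmod_sym.
have ao := oadmissible_iso iso soc' ordE aoc'.
have := gen_iso (s := 1%g : 'S_(size o)) ao aoc' iso erefl.
by rewrite odd_perm1 scale1r; apply=> i; rewrite perm1; apply: ordE.
Qed.

Lemma split_class c (w : 'I_(size c.1).-1.+1) b h :
  valid c -> valid (split_code c w b h) ->
  oriented (G := split_graph (G := code_graph c) w (mask_set _ b) h)
    (new_order (G := code_graph c) (std_order (size c.2)))
  =~ code_class (split_code c w b h).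
Proof.
move=> vc vc'; have /and5P[n0 cr _ _ _] := vc.
have eV : nvert (split_graph (G := code_graph c) w (mask_set _ b) h) =
    nvert (code_graph (split_code c w b h)).
  by rewrite /= size_mkseq prednK.
have eF : nflag (split_graph (G := code_graph c) w (mask_set _ b) h) =
    nflag (code_graph (split_code c w b h)).
  by rewrite /= size_mkseq.
apply: (expand_class (m := (size c.2).+1) vc' (split_code_iso n0 cr eV eF)) => //.
- by rewrite /= size_mkseq.
- by rewrite /= size_map size_std_order.
- by move=> i z im; exact: mem_new_std_order.
Qed.

Lemma loop_class c (w : 'I_(size c.1).-1.+1) :
  valid c -> valid (loop_code c w) ->
  oriented (G := loop_graph (G := code_graph c) w)
    (new_order (G := code_graph c) (std_order (size c.2)))
  =~ code_class (loop_code c w).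
Proof.
move=> vc vc'; have /and5P[n0 cr _ _ _] := vc.
have eV : nvert (loop_graph (G := code_graph c) w) = nvert (code_graph (loop_code c w)).
  by rewrite /= size_mkseq.
have eF : nflag (loop_graph (G := code_graph c) w) = nflag (code_graph (loop_code c w)).
  by [].
apply: (expand_class (m := (size c.2).+1) vc' (loop_code_iso n0 cr eV eF)) => //.
- by rewrite /= size_map size_std_order.
- by move=> i z im; exact: mem_new_std_order.
Qed.

Lemma mem_splittings c w b h : (w < size c.1)%N ->
  b \in words [:: false; true] (size c.2).*2 -> mask_at c w b ->
  (h < (nth 0 c.1 w).+1)%N -> split_stable c w b h ->
  split_code c w b h \in splittings c.
Proof.
move=> wn bw bP hg st; apply/flatten_mapP; exists w; first by rewrite mem_iota.
apply/flatten_mapP; exists b; first by rewrite mem_filter bP.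
by apply: map_f; rewrite mem_filter st mem_iota.
Qed.

Lemma sum_splittings (V : nmodType) c (F : code -> V) :
  \sum_(c' <- splittings c) F c' =
  \sum_(0 <= w < size c.1)
    \sum_(b <- words [:: false; true] (size c.2).*2 | mask_at c w b)
      \sum_(0 <= h < (nth 0%N c.1 w).+1 | split_stable c w b h)
        F (split_code c w b h).
Proof.
rewrite big_flatten big_map /index_iota subn0; apply: eq_bigr => w _.
rewrite big_flatten big_map big_filter; apply: eq_bigr => b _.
by rewrite big_map big_filter subn0.
Qed.

Section DiffCode.
Variable c : code.
Hypothesis vc : valid c.
Let n0 : (0 < size c.1)%N. Proof. by case/and5P: vc. Qed.
Let cr : in_range c. Proof. by case/and5P: vc. Qed.

Lemma mask_atE (w : 'I_(size c.1).-1.+1) b :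
  mask_at c w b = (mask_set _ b \subset @fl 0 (code_graph c) w).
Proof.
apply/allP/subsetP => [bw x|bw x].
  rewrite in_set => xb; rewrite in_set; apply/eqP/val_inj.
  apply: etrans (code_vtx x n0 cr) _; apply/eqP.
  by have := bw x; rewrite mem_iota ltn_ord => /(_ isT)/implyP; apply.
rewrite mem_iota => xm; apply/implyP => xb; pose y : 'I_(size c.2).*2 := Ordinal xm.
have := bw y; rewrite in_set => /(_ xb); rewrite in_set => /eqP/(congr1 val) <-.
exact/eqP/esym/(code_vtx y n0 cr).
Qed.

Lemma card_mask_set b : b \in words [:: false; true] (size c.2).*2 ->
  #|mask_set (size c.2).*2 b| = count id b.
Proof.
rewrite mem_words => /andP[/eqP sb _].
rewrite cardsE cardE size_filter -enumT -{2}(mkseq_nth false b) sb /mkseq -val_enum_ord.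
by rewrite -map_comp count_map.
Qed.

Lemma split_stableE (w : 'I_(size c.1).-1.+1) b h :
  b \in words [:: false; true] (size c.2).*2 -> mask_at c w b ->
  split_stable c w b h =
  (3 <= 2 * h + #|mask_set (size c.2).*2 b|.+1)%N &&
  (3 <= 2 * (@genus 0 (code_graph c) w - h) +
     #|@fl 0 (code_graph c) w :\: mask_set _ b|.+1)%N.
Proof.
move=> bw; rewrite mask_atE => bP.
by rewrite cardsD (setIidPr bP) card_code_fl // card_mask_set.
Qed.

(** Validity of the expansions is assumed rather than derived; for the codes in [reps] it is checked
    by computation. *)
Lemma diff_code_class : all valid (splittings c ++ loopings c) ->
  diff (code_class c) =~
    2%:R^-1 *: (\sum_(c' <- splittings c) code_class c')
    + \sum_(c' <- loopings c) code_class c'.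
Proof.
rewrite all_cat => /andP[/allP vs /allP vl].
have nk := prednK n0.
have wn (w : 'I_(size c.1).-1.+1) : (w < size c.1)%N.
  exact: leq_trans (ltn_ord w) (eq_leq nk).
rewrite diff_gen_U /diff_gen; apply: eqmodD; last first.
  rewrite big_map big_filter -[iota _ _](_ : index_iota 0 (size c.1) = _); last first.
    by rewrite /index_iota subn0.
  rewrite -{1}nk big_mkord; apply: eqmod_sum => w w0; rewrite prod_contract_loop //.
  apply: loop_class => //; apply: vl; apply/mapP; exists (w : nat) => //.
  by rewrite mem_filter w0 mem_iota wn.
apply: eqmodZ; rewrite sum_splittings -[in index_iota _ _]nk big_mkord.
apply: eqmod_sum => w _.
rewrite big_mkcond sum_mask_set -big_mkcondr big_seq_cond [X in _ =~ X]big_seq_cond.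
under [X in _ =~ X]eq_bigl => b do rewrite mask_atE.
apply: eqmod_sum => b /andP[bw]; rewrite -mask_atE => bP.
rewrite big_mkord; under [X in _ =~ X]eq_bigl => h do rewrite split_stableE //.
apply: eqmod_sum => h; rewrite -split_stableE // => st.
rewrite prod_contract_split -?mask_atE //; last by rewrite -ltnS.
by apply: split_class => //; apply: vs; apply: mem_splittings.
Qed.

End DiffCode.

Local Notation "x =~ y" := (eqmod 3 (x : prechain iota_Com 0) y) (at level 70).
(** * Homology *)

Lemma subquot_trivial (V : lmodType rat) (Z B : submodClosed V) :
  {subset Z <= B} -> lmod_iso (subquot Z B) ('rV[rat]_0 : lmodType rat).
Proof.
move=> ZB; have q0 (q : subquot Z B) : q = 0.
  elim/quotW: q => x; apply: etrans (scale0r (\pi_(subquot Z B)%qT x)).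
  rewrite [RHS]pi_sq_scale scale0r; apply/eqP.
  by rewrite -Quotient.idealrBE subr0 rel_inE; apply: ZB; exact: valP.
pose f (q : subquot Z B) : 'rV[rat]_0 := 0.
have lf : linear f by move=> c x y; rewrite scaler0 addr0.
pose lin := GRing.isLinear.Build rat (subquot Z B) ('rV[rat]_0) *:%R f lf.
pose F : {linear subquot Z B -> 'rV[rat]_0} := HB.pack f lin.
by exists F; exists (fun=> 0) => x; [rewrite [RHS]q0 | rewrite [RHS]thinmx0 [LHS]thinmx0].
Qed.

(** [phi] induces the isomorphism, and the class of [c *: z] is the preimage of [c]. *)
Lemma subquot_line (V : lmodType rat) (Z B : submodClosed V)
    (phi : {linear V -> rat^o}) (z : V) :
  z \in Z -> phi z = 1 -> (forall x, x \in B -> phi x = 0) ->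
  (forall x, x \in Z -> phi x = 0 -> x \in B) ->
  lmod_iso (subquot Z B) (rat^o : lmodType rat).
Proof.
move=> zZ phiz phiB phiZ.
pose f (q : subquot Z B) : rat^o := phi (val (repr q)).
have fE (x : submod Z) : f (\pi_(subquot Z B)%qT x) = phi (val x).
  apply/eqP; rewrite -subr_eq0 -linearB -raddfB; apply/eqP/phiB.
  by rewrite -rel_inE Quotient.idealrBE reprK.
have lf : linear f.
  move=> c; elim/quotW=> x; elim/quotW=> y.
  have -> : c *: \pi_(subquot Z B)%qT x + \pi_(subquot Z B)%qT y =
      \pi_(subquot Z B)%qT (c *: x + y).
    by rewrite pi_sqD -pi_sq_scale.
  by rewrite !fE !linearP.
pose lin := GRing.isLinear.Build rat (subquot Z B) rat^o *:%R f lf.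
pose F : {linear subquot Z B -> rat^o} := HB.pack f lin.
have zE (c : rat) : c *: z \in Z by rewrite rpredZ.
pose u c : submod Z := Sub (c *: z) (zE c).
have uE c : val (u c) = c *: z by exact: SubK.
have uF c : f (\pi_(subquot Z B)%qT (u c)) = c.
  by rewrite fE uE linearZ phiz; exact: mulr1.
exists F; exists (fun c => \pi_(subquot Z B)%qT (u c)) => [q|c]; last exact: uF.
elim/quotW: q => x; apply/eqP; rewrite -Quotient.idealrBE rel_inE.
apply: phiZ; first exact: valP.
have := uF (F (\pi_(subquot Z B)%qT x)); rewrite fE => uf.
by apply/eqP; rewrite raddfB subr_eq0; apply/eqP; exact: etrans uf (fE x).
Qed.

(** * Detection of the surviving classes *)

Definition vertex_data (c : code) : seq (nat * nat) := zip (iota 0 (size c.1)) c.1.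
Definition edge_data (w : seq nat) (c : code) : seq nat :=
  [seq 3 ^ nth 0 w e.1 + 3 ^ nth 0 w e.2 | e <- c.2]%N.

(** The computable counterpart of [rep_detector], words over 0, ..., 3 playing the role of
    colourings. *)
Definition detect (r c : code) : int :=
  foldr +%R 0 [seq vsign (edge_data w c) | w <- words (iota 0 4) (size c.1) &
    perm_eq (zip w c.1) (vertex_data r) &&
    perm_eq (edge_data w c) (edge_data (iota 0 (size r.1)) r)].

Lemma sum_words_ffun (V : nmodType) n (F : {ffun 'I_n -> 'I_4} -> V) :
  \sum_s F s = \sum_(w <- words (iota 0 4) n) F [ffun v : 'I_n => inord (nth 0%N w v)].
Proof.
pose col (w : seq nat) : {ffun 'I_n -> 'I_4} := [ffun v : 'I_n => inord (nth 0%N w v)].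
rewrite -(big_map col predT F); apply: perm_big; apply: uniq_perm.
- exact: index_enum_uniq.
- rewrite map_inj_in_uniq ?uniq_words ?iota_uniq // => w w'.
  rewrite !mem_words => /andP[/eqP sw /allP w4] /andP[/eqP sw' /allP w4'] /ffunP ww'.
  apply: (@eq_from_nth _ 0%N); rewrite ?sw ?sw' // => i im.
  have lt4 (u : seq nat) : size u = n -> {in u, forall x, x \in iota 0 4} ->
      (nth 0%N u i < 4)%N.
    by move=> su /(_ (nth 0%N u i)); rewrite mem_iota; apply; rewrite mem_nth ?su.
  have := congr1 (@nat_of_ord 4) (ww' (Ordinal im)).
  by rewrite !ffunE !inordK ?lt4.
move=> s; rewrite mem_index_enum; apply/esym/mapP.
exists [seq (s v : nat) | v <- enum 'I_n].
  rewrite mem_words size_map size_enum_ord eqxx; apply/allP=> _ /mapP[v _ ->].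
  by have : (s v : nat) \in iota 0 4 by rewrite mem_iota ltn_ord.
apply/ffunP=> v; rewrite ffunE (nth_map v) ?size_enum_ord // nth_ord_enum.
by rewrite inord_val.
Qed.

(** Four colours suffice, since no representative has more than four vertices. *)
Definition rep_detector (r : code) (G : graph 0) (o : seq {set 'I_(nflag G)}) : rat :=
  detector 4 (vertex_data r) (edge_data (iota 0 (size r.1)) r) o.

Lemma detectorE r c : valid c ->
  @rep_detector r (code_graph c) (std_order (size c.2)) = (detect r c)%:~R.
Proof.
move=> vc; have /and5P[n0 cr _ _ _] := vc; have nk := prednK n0.
rewrite /rep_detector /detector /detect foldrE big_map big_filter; congr (_%:~R).
rewrite big_mkcond sum_words_ffun -big_mkcondr.
have nvE : nvert (code_graph c) = size c.1 := nk.
rewrite [X in words _ X]nvE.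
rewrite big_seq_cond [RHS]big_seq_cond.
have wE w : w \in words (iota 0 4) (size c.1) ->
    let s := [ffun v : 'I_(size c.1).-1.+1 => inord (nth 0%N w v) : 'I_4] in
    colour_genera (G := code_graph c) s = zip w c.1 /\
    map (colour_edge (G := code_graph c) s) (std_order (size c.2)) = edge_data w c.
  rewrite mem_words => /andP[/eqP sw /allP w4] s.
  have sE (v : 'I_(size c.1).-1.+1) : s v = nth 0%N w v :> nat.
    rewrite ffunE inordK //.
    have : nth 0%N w v \in w by rewrite mem_nth // sw -[X in (_ < X)%N]nk.
    move=> /w4 h; have : nth 0%N w v \in iota 0 4 := h.
    by rewrite mem_iota.
  split.
    apply: (@eq_from_nth _ (0, 0)%N); rewrite size_map size_enum_ord ?nk.
      by rewrite size_zip sw minnn.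
    move=> i im; have im' : (i < (size c.1).-1.+1)%N := im.
    rewrite (nth_map (Ordinal im')) ?size_enum_ord // nth_zip ?sw //.
    by rewrite (nth_ord_enum _ (Ordinal im')) sE.
  apply: (@eq_from_nth _ 0%N); rewrite size_map size_std_order; first by rewrite size_map.
  move=> i im; rewrite (nth_map set0) ?size_std_order // (nth_map (0, 0)%N) //.
  pose j := Ordinal im; rewrite (nth_std_order j) -(edge_of_mkflag j false).
  have invE : @Defs.inv 0 (code_graph c) (mkflag j false) = mkflag j true.
    by rewrite std_invE edge_of_mkflag odd_mkflag.
  rewrite -(@std_edge (size c.1).-1 _ (nth 0%N c.1) (endpoint c.2)) invE /colour_edge.
  rewrite big_setU1 ?big_set1; last by rewrite inE -invE eq_sym std_inv_neq.
  by rewrite !sE !code_vtx // !endpoint_bit.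
apply: eq_big => [w|w /andP[/wE[-> ->]]] //.
by case ww: (w \in _) => //=; have [-> ->] := wE w ww.
Qed.

(** * The complex in terms of the representatives *)

Local Notation "x =~ y" := (eqmod 3 (x : prechain iota_Com 0) y) (at level 70).
Lemma size_nf c : size (nf c).2.2 = size c.2.
Proof.
have sn c' : size (normalize c').2.2 = size c'.2.
  by rewrite /normalize /= (perm_size (perm_sort_edges _)) size_map.
rewrite /nf; case: ifP => _; first exact: sn.
set i := find _ _; have [i_lt|i_ge] := ltnP i (size (code_orbit (normalize c).2)).
  have /mapP[t _ ->] := mem_nth (1, (normalize c).2) i_lt.
  by rewrite sn size_map sn.
by rewrite nth_default // sn.
Qed.

Definition nf_coef (c r : code) : int := if (nf c).2 == r then (nf c).1 else 0.

Lemma code_class_reps c : valid c ->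
  code_class c =~ \sum_(r <- reps) (nf_coef c r)%:~R *: code_class r.
Proof.
move=> vc; have [_ cn] := reduces_nf vc; apply: eqmod_trans cn _.
rewrite /nf_coef; case: (nf_classified vc) => [->|nr].
  rewrite scale0r big1 ?eqmod_refl // => r _.
  by rewrite if_same scale0r.
rewrite (bigD1_seq (nf c).2) //= eqxx big1 ?addr0 ?eqmod_refl // => r.
by rewrite eq_sym => /negPf ->; rewrite scale0r.
Qed.

Definition coef (s : seq code) (r : code) : int :=
  foldr +%R 0 [seq nf_coef c r | c <- s].

Lemma sum_code_class_reps s : all valid s ->
  \sum_(c <- s) code_class c =~ \sum_(r <- reps) (coef s r)%:~R *: code_class r.
Proof.
elim: s => [_|c s IH /= /andP[vc /IH cs]].
  by rewrite big_nil big1 ?eqmod_refl // => r _; rewrite scale0r.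
rewrite big_cons; apply: eqmod_trans (eqmodD (code_class_reps vc) cs) _.
rewrite -big_split /=; apply: eqmod_sum => r _.
by rewrite rmorphD scalerDl eqmod_refl.
Qed.

(* twice the matrix entry of the differential *)
Definition dcoef (c r : code) : int :=
  coef (splittings c) r + coef (loopings c) r *+ 2.

Lemma reps_valid : all (fun r => valid r && all valid (splittings r ++ loopings r)) reps.
Proof. by vm_compute. Qed.

Lemma diff_code_class_reps c : c \in reps ->
  diff (code_class c) =~
    2%:R^-1 *: \sum_(r <- reps) (dcoef c r)%:~R *: code_class r.
Proof.
move=> /(allP reps_valid)/andP[vc ve]; apply: eqmod_trans (diff_code_class vc ve) _.
move: ve; rewrite all_cat => /andP[vs vl].
apply: eqmod_trans.
  exact: eqmodD (eqmodZ _ (sum_code_class_reps vs)) (sum_code_class_reps vl).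
rewrite !scaler_sumr -big_split /=; apply: eqmod_sum => r _.
rewrite /dcoef rmorphD scalerDl scalerDr rmorphMn /=.
rewrite -[X in _ =~ _ + _ *: X]scalerMnl -[X in _ =~ _ + _ *: X]scaler_nat.
by rewrite [X in _ =~ _ + X]scalerA mulVf // scale1r eqmod_refl.
Qed.

Definition rep_form (u : code) : prechain iota_Com 0 -> rat^o :=
  functional (@rep_detector u).

HB.instance Definition _ u := GRing.Linear.on (rep_form u).

Lemma rep_form_eqmod u x y : x =~ y -> rep_form u x = rep_form u y.
Proof.
move=> xy; apply/eqP; rewrite -subr_eq0 -linearB; apply/eqP.
exact: (functional_rel (@detector_invariant _ _ _ _) xy).
Qed.

(** The detector of a differential is the functional of [codiff], which is itself invariant. *)
Lemma rep_form_diff_eqmod u x y : x =~ y -> rep_form u (diff x) = rep_form u (diff y).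
Proof.
move=> xy; apply/eqP; rewrite -subr_eq0 -!linearB; apply/eqP.
apply: etrans (functional_diff _ _) _.
exact: (functional_rel (codiff_invariant (@detector_invariant _ _ _ _)) xy).
Qed.

Lemma rep_form_class u c : valid c -> rep_form u (code_class c) = (detect u c)%:~R.
Proof.
move=> vc; rewrite /rep_form functional_U detectorE // /prod_form big1 ?mulr1 //.
Qed.

Definition ddetect (u c : code) : int :=
  foldr +%R 0 [seq dcoef c r * detect u r | r <- reps].

Lemma rep_form_diff_class u c : c \in reps ->
  rep_form u (diff (code_class c)) = 2%:R^-1 * (ddetect u c)%:~R.
Proof.
move=> cr; rewrite (rep_form_eqmod _ (diff_code_class_reps cr)) linearZ linear_sum /=.
rewrite /ddetect foldrE big_map rmorph_sum /=; congr (_ * _).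
apply: eq_big_seq => r /(allP reps_valid)/andP[vr _].
by rewrite linearZ /= rep_form_class // rmorphM.
Qed.

Definition deg (c : code) : int := - (size c.2)%:Z.

Lemma chains_reps d x : chains 3 d x ->
  exists a : code -> rat,
    x =~ \sum_(r <- reps | deg r == d) a r *: code_class r.
Proof.
move=> cx; rewrite (prechainE x) big_seq.
pose K (x : prechain iota_Com 0) := exists a : code -> rat,
  x =~ \sum_(r <- reps | deg r == d) a r *: code_class r.
apply: (big_ind K).
- by exists (fun=> 0); rewrite big1 ?eqmod_refl // => r _; rewrite scale0r.
- move=> y z [a ya] [b zb]; exists (fun r => a r + b r).
  apply: eqmod_trans (eqmodD ya zb) _; rewrite -big_split.
  by apply: eqmod_sum => r _; rewrite scalerDl eqmod_refl.
move=> k; rewrite -mcoeff_neq0 => /cx; case: k (x@_k) => G o p xk [ak dk].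
have [mG oG _] := ak; have [c [vc sc oc]] := code_of_graph (conj mG oG).
exists (fun r => xk * (p (@unit_decor 0 G) * (nf_coef c r)%:~R)).
apply: eqmod_trans (eqmodZ _ (gen_rel ak)) _.
apply: eqmod_trans (eqmodZ _ (eqmodZ _ oc)) _.
apply: eqmod_trans (eqmodZ _ (eqmodZ _ (code_class_reps vc))) _.
rewrite !scaler_sumr [X in _ =~ X]big_mkcond; apply: eqmod_sum => r _.
case: ifP => dr; first by rewrite !scalerA mulrA eqmod_refl.
(* Normal forms keep the number of edges, so representatives of another degree do not occur. *)
have -> : nf_coef c r = 0; last by rewrite scale0r !scaler0 eqmod_refl.
rewrite /nf_coef; case: eqP => // rE; move: dr.
by rewrite -rE /deg size_nf sc -dk eqxx.
Qed.

Lemma rel_boundaries d x : x \in spanp (@relator iota_Com 3 0) -> x \in boundaries 3 d.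
Proof.
move=> /asboolP; elim=> [|c {}x y Rx _ IH]; first exact: rpred0.
rewrite rpredD // rpredZ //; apply/asboolP; rewrite -[x]addr0 -[x]scale1r.
by right=> //; [left | left].
Qed.

Lemma diff_boundaries d y :
  chains 3 (d + 1) y -> diff y \in @boundaries iota_Com 3 0 d.
Proof.
move=> cy; apply/asboolP; rewrite -[diff y]addr0 -[diff y]scale1r.
by right=> //; [right; exists y | left].
Qed.

Lemma eqmod_boundaries d x y : x =~ y -> y \in boundaries 3 d -> x \in boundaries 3 d.
Proof. by move=> /(rel_boundaries d) xy By; rewrite -(subrK y x) rpredD. Qed.

Lemma chains_class c k : valid c -> chains 3 (deg c) (k *: code_class c).
Proof.
move=> vc y; rewrite mcoeffZ mcoeffU; case: (_ =P y) => [<- _|_]; last by rewrite mulr0 eqxx.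
split; first exact/admissible_prod1/code_admissible.
by rewrite /degree /= size_std_order.
Qed.

(** * Exactness outside degree -6 and the surviving class *)

Local Notation "x =~ y" := (eqmod 3 (x : prechain iota_Com 0) y) (at level 70).
Lemma cyclesP d x : x \in @cycles iota_Com 3 0 d ->
  chains 3 d x /\ diff x \in spanp (@relator iota_Com 3 0).
Proof. by move=> /asboolP[cx dx]; split=> //; apply/asboolP. Qed.

Lemma rep_form_cycle u d x : x \in @cycles iota_Com 3 0 d -> rep_form u (diff x) = 0.
Proof. by move=> /cyclesP[_]; apply: functional_rel (@detector_invariant _ _ _ _). Qed.

Lemma sum_reps2 d t s (a : code -> rat) : [seq r <- reps | deg r == d] = [:: t; s] ->
  \sum_(r <- reps | deg r == d) a r *: code_class r =
  a t *: code_class t + a s *: code_class s.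
Proof. by move=> ts; rewrite -big_filter ts big_cons big_seq1. Qed.

(* The differential of p is a combination of the classes of t and s in which t
   occurs, so that the class of t is a multiple of that of s up to a boundary. *)
Definition kills (p t s : code) : bool :=
  all (fun r => (r \in [:: t; s]) || (dcoef p r == 0)) reps && (dcoef p t != 0).

(** The factor 2 compensates for [dcoef] being twice the matrix entry. *)
Lemma kills_boundary p t s : p \in reps -> t \in reps -> s \in reps -> t != s ->
  kills p t s ->
  diff ((2%:R / (dcoef p t)%:~R) *: code_class p) =~
    code_class t + ((dcoef p s)%:~R / (dcoef p t)%:~R) *: code_class s.
Proof.
move=> pr tr sr ts /andP[/allP pz pt]; rewrite linearZ /=.
have pt0 : (dcoef p t)%:~R != 0 :> rat by rewrite intr_eq0.
apply: eqmod_trans (eqmodZ _ (diff_code_class_reps pr)) _.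
have -> : \sum_(r <- reps) (dcoef p r)%:~R *: code_class r =
    (dcoef p t)%:~R *: code_class t + (dcoef p s)%:~R *: code_class s.
  rewrite (bigD1_seq t) //= big_mkcond (bigD1_seq s) //= eq_sym ts.
  rewrite big_seq_cond big1 ?addr0 // => r /andP[rr rs]; case: ifP => // rt.
  by have := pz r rr; rewrite !inE (negPf rt) (negPf rs) => /eqP ->; rewrite scale0r.
rewrite scalerA scalerDr !scalerA.
have -> : 2%:R / (dcoef p t)%:~R * 2%:R^-1 * (dcoef p t)%:~R = 1 :> rat by field.
have -> : 2%:R / (dcoef p t)%:~R * 2%:R^-1 * (dcoef p s)%:~R =
  (dcoef p s)%:~R / (dcoef p t)%:~R :> rat by field.
by rewrite scale1r eqmod_refl.
Qed.

(** Degree [d] is spanned by [t] and [s]. The detector [u] does not vanish on the differential of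
    [s], so it confines the coefficients of a cycle to a line. The last equation says that [u]
    vanishes on the differential of the differential of [p], which places the boundary of [p] on
    this line. *)
Definition exact_cert (d : int) (p t s u : code) : bool :=
  [&& [seq r <- reps | deg r == d] == [:: t; s], deg p == d + 1,
      all [in reps] [:: p; t; s] && (t != s), kills p t s, ddetect u s != 0 &
      dcoef p t * ddetect u t + dcoef p s * ddetect u s == 0].

Lemma exact_cert_boundary d p t s u x :
  exact_cert d p t s u -> x \in @cycles iota_Com 3 0 d -> x \in @boundaries iota_Com 3 0 d.
Proof.
case/and5P=> /eqP dts /eqP dp /andP[/and4P[pr tr sr _] ts] kp /andP[us /eqP dd] xZ.
have [cx _] := cyclesP xZ; have [a xa] := chains_reps cx.
rewrite (sum_reps2 _ dts) in xa.
have := rep_form_cycle u xZ; rewrite (rep_form_diff_eqmod u xa) !linearD !linearZ /=.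
rewrite !rep_form_diff_class // => a0.
have /andP[_ pt] := kp.
have pt0 : (dcoef p t)%:~R != 0 :> rat by rewrite intr_eq0.
have us0 : (ddetect u s)%:~R != 0 :> rat by rewrite intr_eq0.
have dd0 : (dcoef p t)%:~R * (ddetect u t)%:~R +
    (dcoef p s)%:~R * (ddetect u s)%:~R = 0 :> rat.
  by rewrite -!rmorphM -rmorphD dd.
(* The coefficients of the cycle and those of the boundary of [p] satisfy the same linear equation,
   in which the coefficient of [s] is non-zero; hence they are proportional. *)
have ats : a s = a t * ((dcoef p s)%:~R / (dcoef p t)%:~R).
  apply: (mulIf us0); apply: (mulIf pt0).
  have {}a0 : a t * (ddetect u t)%:~R + a s * (ddetect u s)%:~R = 0.
    have := congr1 ( *%R 2%:R) a0; rewrite mulr0 => <-.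
    by rewrite /GRing.scale /=; field.
  transitivity (a t * ((dcoef p s)%:~R * (ddetect u s)%:~R)); last by field.
  have -> : (dcoef p s)%:~R * (ddetect u s)%:~R =
    - ((dcoef p t)%:~R * (ddetect u t)%:~R) :> rat.
    by apply/eqP; rewrite -addr_eq0 addrC dd0.
  have -> : a s * (ddetect u s)%:~R = - (a t * (ddetect u t)%:~R).
    by apply/eqP; rewrite -addr_eq0 addrC a0.
  by ring.
pose y := (a t * (2%:R / (dcoef p t)%:~R)) *: code_class p.
apply: (eqmod_boundaries (y := diff y)); last first.
  apply: diff_boundaries; rewrite -dp; apply: chains_class.
  by have /andP[] := allP reps_valid p pr.
apply: eqmod_trans xa _; rewrite /y -scalerA linearZ /= ats.
rewrite -[in X in X =~ _]scalerA -scalerDr.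
by apply/eqmodZ/eqmod_sym/kills_boundary.
Qed.

Local Notation rep i := (nth ([::], [::]) reps i).

(** Entries [2e - 2] and [2e - 1] form one pair, entries [2e] and [2e + 1] the next: the second
    member of each arises from the first by trading genus for a loop. *)
Lemma exact_certs :
  all (fun e => exact_cert (- e%:Z) (rep e.*2.-2) (rep e.*2.-1) (rep e.*2) (rep e.*2.+1))
    [:: 1; 2; 3; 4; 5]%N.
Proof. by vm_compute. Qed.

Lemma exact_low d x : d != - 6 ->
  x \in @cycles iota_Com 3 0 d -> x \in @boundaries iota_Com 3 0 d.
Proof.
move=> d6 xZ; have [cx _] := cyclesP xZ; have [a xa] := chains_reps cx.
have [hd|nd] := boolP (has (fun r => deg r == d) reps); last first.
  by apply: (eqmod_boundaries xa); rewrite big_hasC ?rpred0.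
have small : all (fun r => size r.2 <= 6)%N reps by [].
case/hasP: hd => r rr /eqP rd; have r6 := allP small r rr.
(* In degree 0 the only class is the single vertex of genus 3. Its differential contains the loop on
   a vertex of genus 2, so no non-zero multiple of it is a cycle. *)
have [e0|e0] := eqVneq (size r.2) 0%N.
  have {rd}d0 : d = 0 by rewrite -rd /deg e0.
  have reps0 : [seq r <- reps | deg r == 0] = [:: rep 0] by [].
  have dd0 : ddetect (rep 1) (rep 0) != 0 by vm_compute.
  subst d; rewrite -big_filter reps0 big_seq1 in xa.
  have := rep_form_cycle (rep 1) xZ; rewrite (rep_form_diff_eqmod _ xa) !linearZ /=.
  rewrite rep_form_diff_class // => /eqP; rewrite !mulf_eq0 intr_eq0 (negPf dd0) !orbF.
  by move=> /eqP a0; apply: (eqmod_boundaries xa); rewrite a0 scale0r rpred0.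
have e_in : size r.2 \in [:: 1; 2; 3; 4; 5]%N.
  have : size r.2 != 6%N by apply: contraNneq d6 => e6; rewrite -rd /deg e6.
  by move: r6 e0 => /=; case: (size _) => [|[|[|[|[|[|[|m]]]]]]].
by have := allP exact_certs _ e_in; rewrite -[- _]/(deg r) rd => /exact_cert_boundary; apply.
Qed.

Lemma rep_form_boundary u d x :
  all (fun r => ddetect u r == 0) [seq r <- reps | deg r == d + 1] ->
  x \in @boundaries iota_Com 3 0 d -> rep_form u x = 0.
Proof.
move=> dd0 /asboolP; elim=> [|c {}x y xB _ IH]; first exact: linear0.
rewrite [LHS](functional_linear _ c x y) -/(rep_form u y) IH addr0.
suff xK : rep_form u x = 0 by rewrite -/(rep_form u x) xK scaler0.
case: xB => [Rx|[z cz ->]].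
  exact: functional_rel (@detector_invariant _ _ _ _) (relator_rel Rx).
have [a za] := chains_reps cz; rewrite (rep_form_diff_eqmod _ za).
rewrite (linear_sum (@diff iota_Com 0)) (linear_sum (rep_form u)).
rewrite big_seq_cond big1 // => r /andP[rr dr].
rewrite !linearZ /= rep_form_diff_class //.
have /eqP -> : ddetect u r == 0 by apply: (allP dd0); rewrite mem_filter dr.
by rewrite mulr0; exact: mulr0.
Qed.

Lemma unsplittable_cycle c k : valid c ->
  splittings c = [::] -> loopings c = [::] ->
  k *: code_class c \in @cycles iota_Com 3 0 (deg c).
Proof.
move=> vc sc lc; apply/asboolP; split; first exact: chains_class.
apply/(asboolP (in_span _ _)).
change (diff (k *: code_class c) \in spanp (@relator iota_Com 3 0)).
rewrite linearZ rpredZ //; have := diff_code_class vc.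
by rewrite sc lc !big_nil scaler0 addr0 => /(_ isT); rewrite /eqmod subr0.
Qed.

(** The class of [t] is a boundary up to a factor, and the detector of [u] vanishes on [t] but not
    on [u]. It thus serves as a coordinate on the homology in degree [d]. *)
Definition line_cert (d : int) (p t u : code) : bool :=
  [&& [seq r <- reps | deg r == d] == [:: t; u], deg p == d + 1,
      all [in reps] [:: p; t; u] && (t != u), kills p t u && (dcoef p u == 0) &
      (detect u t == 0) && (detect u u != 0)].

Lemma line_cert_boundary d p t u x : line_cert d p t u ->
  x \in @cycles iota_Com 3 0 d -> rep_form u x = 0 ->
  x \in @boundaries iota_Com 3 0 d.
Proof.
case/and5P=> /eqP dtu /eqP dp /andP[/and4P[pr tr ur _] tu] /andP[kp /eqP pu].
move=> /andP[/eqP ut uu] /cyclesP[cx _]; have [a xa] := chains_reps cx.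
have rv r : r \in reps -> valid r by move=> /(allP reps_valid)/andP[].
rewrite (sum_reps2 _ dtu) in xa; rewrite (rep_form_eqmod _ xa) linearD !linearZ /=.
rewrite !rep_form_class ?rv // ut scaler0 add0r => /eqP.
rewrite mulf_eq0 intr_eq0 (negPf uu) orbF => /eqP au; rewrite au scale0r addr0 in xa.
apply: (eqmod_boundaries xa); rewrite rpredZ //.
have := kills_boundary pr tr ur tu kp.
rewrite pu mul0r scale0r addr0 => /eqmod_sym/eqmod_boundaries; apply.
by apply: diff_boundaries; rewrite -dp; apply: chains_class; exact: rv.
Qed.

Theorem corollary1p2 (d : int) :
  lmod_iso (homology iota_Com 3 0 d)
           (if d == - 6 then (rat^o : lmodType rat)
            else ('rV[rat]_0 : lmodType rat)).
Proof.
case: ifP => [/eqP -> | /negbT d6]; last first.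
  by apply: subquot_trivial => x; exact: exact_low.
pose K4 := rep 12.
have K4r : K4 \in reps by [].
have cert : line_cert (- 6) (rep 10) (rep 11) K4 by vm_compute.
(* The vertices of the complete graph are trivalent of genus 0 and have no stable expansion. *)
have rigid : (splittings K4 == [::]) && (loopings K4 == [::]) by vm_compute.
(* Contracting an edge of the complete graph creates double edges, so it occurs in no boundary. *)
have dd0 : all (fun r => ddetect K4 r == 0) [seq r <- reps | deg r == - 6 + 1].
  by vm_compute.
have dK : deg K4 = - 6 by [].
(* The value of [K4] is forgotten; what follows relies on the certificates alone. *)
move: K4 K4r cert rigid dd0 dK => K4 K4r cert /andP[/eqP sK /eqP lK] dd0 dK.
have vK : valid K4 by case/andP: (allP reps_valid K4 K4r).
(* All 24 automorphisms of the complete graph permute its edges evenly, so their signs add up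
   instead of cancelling. *)
have uK : (detect K4 K4)%:~R != 0 :> rat.
  by rewrite intr_eq0; case/and5P: cert => _ _ _ _ /andP[].
apply: (@subquot_line _ _ _ (rep_form K4) ((detect K4 K4)%:~R^-1 *: code_class K4)).
- by rewrite -dK; exact: unsplittable_cycle.
- apply: etrans (linearZ _ _) _.
  exact: etrans (congr1 ( *:%R _) (rep_form_class K4 vK)) (mulVf uK).
- by move=> x; exact: rep_form_boundary.
- by move=> x; exact: line_cert_boundary cert.
Qed.
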